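(* Let $R=\bigoplus_{\alpha\in\Gamma}R_{\alpha}$ be a graded integral domain and let $\star$ be a semistar operation on $R$ such that $R^{\star}\subsetneq R_H$. Then the following statements are equivalent: (1) $R$ is a GP$\star$MD; (2) each homogeneously $(\star,t)$-linked overring of $R$ is a P$v$MD; (3) each homogeneously $(\star,d)$-linked overring of $R$ is a graded-Prüfer domain; (4) each homogeneously $(\star,t)$-linked overring of $R$ is integrally closed; (5) each homogeneously $(\star,d)$-linked overring of $R$ is integrally closed.
   Context: $\Gamma$ is a commutative cancellative monoid (written additively) whose quotient group $\langle\Gamma\rangle$ is torsion-free. A graded integral domain $R=\bigoplus_{\alpha\in\Gamma}R_\alpha$ is an integral domain that is the direct sum of additive subgroups $R_\alpha$ with $R_\alpha R_\beta\subseteq R_{\alpha+\beta}$. $K$ is its quotient field, $H$ the set of nonzero homogeneous elements, $R_H=\bigoplus_{\alpha\in\langle\Gamma\rangle}(R_H)_\alpha$ the homogeneous quotient field. A homogeneous overring of $R$ is a ring $T$ with $R\subseteq T\subseteq R_H$ and $T=\bigoplus_\alpha(T\cap(R_H)_\alpha)$ (a graded integral domain). A semistar operation on $R$ is a map $\star$ from the set of nonzero $R$-submodules of $K$ to itself such that for all $0\ne x\in K$ and $E,F$: $(xE)^\star=xE^\star$; $E\subseteq F\Rightarrow E^\star\subseteq F^\star$; $E\subseteq E^\star$; $(E^\star)^\star=E^\star$. $\star_f$: $E^{\star_f}=\bigcup\{F^\star: F\subseteq E$ nonzero finitely generated fractional ideal$\}$. A nonzero fractional ideal $I$ is $\star_f$-invertible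 if $(I(R:I))^{\star_f}=R^\star$, where $(R:I)=\{x\in K: xI\subseteq R\}$. $R$ is a GP$\star$MD if every nonzero finitely generated homogeneous ideal of $R$ is $\star_f$-invertible; a graded-Prüfer domain is one in which every nonzero finitely generated homogeneous ideal is invertible. On a domain $T$: $d$ is the identity operation, $v$ is $E\mapsto (T:(T:E))$, and $t=v_f$. A P$v$MD is a domain in which every nonzero finitely generated ideal is $t$-invertible. For a homogeneous overring $T$ of $R$ and a semistar operation $\star'$ on $T$, $T$ is a homogeneously $(\star,\star')$-linked overring of $R$ if for each nonzero homogeneous finitely generated ideal $F$ of $R$, $F^\star=R^\star$ implies $(FT)^{\star'}=T^{\star'}$. *)

(* Defs.v *)
From HB Require Import structures.
From mathcomp Require Import all_boot all_algebra.
From mathcomp Require Import boolp classical_sets.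
Set Implicit Arguments. Unset Strict Implicit. Unset Printing Implicit Defensive.
Import GRing.Theory.
Local Open Scope ring_scope.
Local Open Scope classical_set_scope.

Section GradedDefs.
Variable K : fieldType.   (* the quotient field of R *)
Variable G : zmodType.    (* the quotient group <Gamma> of the grading monoid *)

(* Gamma is a submonoid of the torsion-free abelian group G that generates G;
   G is then the quotient group <Gamma>, and Gamma is cancellative. *)
Definition grading_monoid (Gam : set G) : Prop :=
  [/\ Gam 0,
      (forall a b, Gam a -> Gam b -> Gam (a + b)),
      (forall g, exists a b, [/\ Gam a, Gam b & g = a - b]) &
      (forall (n : nat) (g : G), g *+ n.+1 = 0 -> g = 0)].

Definition is_submod (D E : set K) : Prop :=
  [/\ E 0, (forall x y, E x -> E y -> E (x + y)) &
      (forall r x, D r -> E x -> E (r * x))].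

Definition nonzero (E : set K) : Prop := exists x, x != 0 /\ E x.

Definition nz_submod (D E : set K) : Prop := is_submod D E /\ nonzero E.

Definition smul (x : K) (E : set K) : set K := [set y | exists2 z, E z & y = x * z].

Definition gen (D : set K) (s : seq K) : set K :=
  [set y | exists r : nat -> K, (forall i, D (r i)) /\
           y = \sum_(i < size s) r i * s`_i].

Definition fin_gen (D E : set K) : Prop := exists s, E = gen D s.

Definition prodm (E F : set K) : set K :=
  [set z | exists s : seq (K * K),
     (forall p, p \in s -> E p.1 /\ F p.2) /\ z = \sum_(p <- s) p.1 * p.2].

Definition colon (D E : set K) : set K := [set x | forall y, E y -> D (x * y)].

Definition is_semistar (D : set K) (st : set K -> set K) : Prop :=
  forall E F : set K, nz_submod D E -> nz_submod D F ->
  [/\ nz_submod D (st E),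
      (forall x, x != 0 -> st (smul x E) = smul x (st E)),
      (E `<=` F -> st E `<=` st F),
      E `<=` st E &
      st (st E) = st E].

Definition star_f (D : set K) (st : set K -> set K) (E : set K) : set K :=
  [set y | exists F : set K,
     [/\ fin_gen D F, nonzero F, F `<=` E & st F y]].

Definition f_invertible (D : set K) (st : set K -> set K) (I : set K) : Prop :=
  star_f D st (prodm I (colon D I)) = st D.

Definition d_op (E : set K) : set K := E.
Definition v_op (D : set K) (E : set K) : set K := colon D (colon D E).
Definition t_op (D : set K) : set K -> set K := star_f D (v_op D).

Definition is_subring (D : set K) : Prop :=
  [/\ D 0, D 1, (forall x y, D x -> D y -> D (x - y)) &
      (forall x y, D x -> D y -> D (x * y))].

Definition decomposes (C : G -> set K) (x : K) : Prop :=
  exists (s : seq G) (f : G -> K),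
    [/\ uniq s, (forall a, a \in s -> C a (f a)) & x = \sum_(a <- s) f a].

Definition graded_domain (Gam : set G) (R : set K) (C : G -> set K) : Prop :=
  [/\ grading_monoid Gam, is_subring R,
      (forall x, exists a b, [/\ R a, R b, b != 0 & x = a / b]) &
   [/\
      (forall a, C a `<=` R /\ C a 0 /\
                 forall x y, C a x -> C a y -> C a (x - y)),
      (forall a x, C a x -> x != 0 -> Gam a),
      (forall a b x y, C a x -> C b y -> C (a + b) (x * y)) &
      (forall x, R x -> decomposes C x) /\
      (forall (s : seq G) (f : G -> K), uniq s -> (forall a, a \in s -> C a (f a)) ->
         \sum_(a <- s) f a = 0 -> forall a, a \in s -> f a = 0)]].

Definition homog_ideal (D : set K) (C : G -> set K) (I : set K) : Prop :=
  [/\ is_submod D I, I `<=` D &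
      forall x, I x -> decomposes (fun a => C a `&` I) x].

Definition nz_fg_homog_ideal (D : set K) (C : G -> set K) (I : set K) : Prop :=
  [/\ homog_ideal D C I, fin_gen D I & nonzero I].

Definition RH (C : G -> set K) (R : set K) : set K :=
  [set x | exists a h g, [/\ R a, C g h, h != 0 & x = a / h]].

Definition RH_comp (C : G -> set K) (al : G) : set K :=
  [set x | exists b g a h, [/\ C b a, C g h, h != 0, b - g = al & x = a / h]].

Definition over_comp (C : G -> set K) (T : set K) (al : G) : set K :=
  T `&` RH_comp C al.

Definition homog_overring (R : set K) (C : G -> set K) (T : set K) : Prop :=
  [/\ is_subring T, R `<=` T, T `<=` RH C R &
      forall x, T x -> decomposes (over_comp C T) x].

Definition GPstarMD (R : set K) (C : G -> set K) (st : set K -> set K) : Prop :=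
  forall I, nz_fg_homog_ideal R C I -> f_invertible R st I.

Definition graded_Prufer (C : G -> set K) (T : set K) : Prop :=
  forall I, nz_fg_homog_ideal T (over_comp C T) I ->
    prodm I (colon T I) = T.

Definition PvMD (T : set K) : Prop :=
  forall I, is_submod T I -> I `<=` T -> fin_gen T I -> nonzero I ->
    t_op T (prodm I (colon T I)) = t_op T T.

Definition int_closed (T : set K) : Prop :=
  forall (p : {poly K}) (x : K), p \is monic -> (forall i, T p`_i) ->
    root p x -> T x.

Definition homog_linked (R : set K) (C : G -> set K) (st : set K -> set K)
    (T : set K) (st' : set K -> set K) : Prop :=
  homog_overring R C T /\
  forall F, nz_fg_homog_ideal R C F -> st F = st R ->
    st' (prodm F T) = st' T.

End GradedDefs.

(* Main.v *)
(** Call a finitely generated ideal I of T t-invertible if I u has v-closure T for some finite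
    u in (T : I).  The heart of the matter is that a graded domain T whose homogeneous finitely
    generated ideals are t-invertible is a PvMD.  Filter the degrees by subgroups S, adjoining one
    degree g at a time.  If a multiple of g lies in S nothing changes; otherwise elements become
    one-variable polynomials with S-homogeneous coefficients.  After inverting the S-homogeneous
    elements the Euclidean algorithm makes a finitely generated ideal principal, so up to a factor
    only multipliers x of the localization with x F in T matter; by the Dedekind--Mertens inclusion
    and the t-invertibility of the powers of the content, such an x multiplies the whole content of
    F into T, and that content is t-invertible.  A PvMD is integrally closed.

    A homogeneous inverse over R extends to every linked overring, which gives (1) => (2), (3).
    For (5) => (1), suppose that I0 = I (R : I) is contained in a homogeneous ideal M maximal
    among those containing no J with J^* = R^*; M is prime for homogeneous elements.  All
    homogeneous overrings of the localization R_M are linked, hence integrally closed.  Applied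
    to R_M[u^2], this puts u or 1/u in R_M for every homogeneous u (Seidenberg), so one generator of
    I divides all the others in R_M, and I0 meets the complement of M. *)
Require Import Defs.
From HB Require Import structures.
From mathcomp Require Import all_boot all_algebra.
From mathcomp Require Import boolp classical_sets.
From mathcomp Require Import ring zify.
Import GRing.Theory.
Local Open Scope classical_set_scope.

Set Implicit Arguments.
Unset Strict Implicit.
Unset Printing Implicit Defensive.

(** * Additive subgroups given as predicates *)

Section Subgroups.
Local Open Scope ring_scope.
Variable V : zmodType.

Definition subgrp (S : set V) := S 0 /\ forall x y, S x -> S y -> S (x - y).

Variable S : set V.
Hypothesis gS : subgrp S.

Lemma subgrp0 : S 0. Proof. by case: gS. Qed.

Lemma subgrpB x y : S x -> S y -> S (x - y). Proof. by case: gS => _; apply. Qed.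

Lemma subgrpN x : S x -> S (- x).
Proof. by move=> Sx; rewrite -sub0r; apply: subgrpB => //; apply: subgrp0. Qed.

Lemma subgrpD x y : S x -> S y -> S (x + y).
Proof. by move=> Sx Sy; rewrite -[y]opprK; apply: subgrpB => //; apply: subgrpN. Qed.

Lemma subgrpMn x n : S x -> S (x *+ n).
Proof.
move=> Sx; elim: n => [|n IH]; first by rewrite mulr0n; apply: subgrp0.
by rewrite mulrS; apply: subgrpD.
Qed.

Lemma subgrp_sum (I : Type) (r : seq I) (P : pred I) (F : I -> V) :
  (forall i, P i -> S (F i)) -> S (\sum_(i <- r | P i) F i).
Proof.
by move=> SF; apply: (big_ind S) => //; [apply: subgrp0 | move=> *; apply: subgrpD].
Qed.

Lemma subgrp_sum_seq (I : eqType) (r : seq I) (F : I -> V) :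
  (forall i, i \in r -> S (F i)) -> S (\sum_(i <- r) F i).
Proof. by move=> SF; rewrite big_seq; apply: subgrp_sum. Qed.

End Subgroups.

(** * Sums of homogeneous elements *)

Section HomogeneousSums.
Local Open Scope ring_scope.
Variables (K : fieldType) (G : zmodType).
Implicit Types (E : G -> set K) (P : set G) (x y : K).

(** Degrees may repeat in the list, so sums are formed by concatenation; [hsum_uniq] merges equal
    degrees where directness is used. *)
Definition hsum E P : set K :=
  [set x | exists l : seq (G * K),
     (forall p, p \in l -> P p.1 /\ E p.1 p.2) /\ x = \sum_(p <- l) p.2].

Lemma hsum0 E P : hsum E P 0.
Proof. by exists [::]; split=> //; rewrite big_nil. Qed.

Lemma hsum_homog E P a x : E a x -> P a -> hsum E P x.
Proof.
move=> Ex Pa; exists [:: (a, x)]; split; last by rewrite big_seq1.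
by move=> p; rewrite inE => /eqP ->.
Qed.

Lemma hsum_mono E P P' : (forall a, P a -> P' a) -> hsum E P `<=` hsum E P'.
Proof. by move=> PP x [l [Hl ->]]; exists l; split=> // p /Hl [/PP]. Qed.

Lemma hsumD E P x y : hsum E P x -> hsum E P y -> hsum E P (x + y).
Proof.
move=> [l [Hl ->]] [k [Hk ->]]; exists (l ++ k); split; last by rewrite big_cat.
by move=> p; rewrite mem_cat => /orP [/Hl|/Hk].
Qed.


Lemma hsum_subset E P (W : set K) : subgrp W -> (forall a, P a -> E a `<=` W) ->
  hsum E P `<=` W.
Proof.
move=> gW EW x [l [Hl ->]]; apply: subgrp_sum_seq => // p /Hl [] /EW; exact.
Qed.

Lemma hsum_subgrp E P : (forall a, subgrp (E a)) -> subgrp (hsum E P).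
Proof.
move=> gE; split=> [|x y Hx [l [Hl ->]]]; first exact: hsum0.
apply: hsumD => //; exists [seq (p.1, - p.2) | p <- l]; split.
  by move=> _ /mapP [p /Hl [Pp Ep] ->] /=; split=> //; apply: (subgrpN (gE _)).
by rewrite big_map /= sumrN.
Qed.

Lemma hsumM E1 E2 E3 P1 P2 P3 x y :
  (forall a b u v, E1 a u -> E2 b v -> E3 (a + b) (u * v)) ->
  (forall a b, P1 a -> P2 b -> P3 (a + b)) ->
  hsum E1 P1 x -> hsum E2 P2 y -> hsum E3 P3 (x * y).
Proof.
move=> EM PM [l [Hl ->]] [k [Hk ->]].
exists [seq (p.1 + q.1, p.2 * q.2) | p <- l, q <- k]; split.
  move=> _ /allpairsP [[p q] /= [/Hl [Pp Ep] /Hk [Pq Eq] ->]] /=.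
  by split; [apply: PM | apply: EM].
rewrite big_allpairs_dep /= mulr_suml; apply: eq_bigr => p _.
by rewrite mulr_sumr.
Qed.

Lemma hsum_split E P Q x : hsum E Q x ->
  exists y z, [/\ hsum E (fun a => Q a /\ P a) y, hsum E (fun a => Q a /\ ~ P a) z & x = y + z].
Proof.
move=> [l [Hl ->]].
exists (\sum_(p <- l | `[<P p.1>]) p.2), (\sum_(p <- l | ~~ `[<P p.1>]) p.2); split.
- exists [seq p <- l | `[<P p.1>]]; split; last by rewrite big_filter.
  by move=> p; rewrite mem_filter => /andP [/asboolP ? /Hl []].
- exists [seq p <- l | ~~ `[<P p.1>]]; split; last by rewrite big_filter.
  by move=> p; rewrite mem_filter => /andP [/asboolPn ? /Hl []].
- by rewrite (bigID (fun p => `[<P p.1>])).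
Qed.

Lemma hsum_uniq E P x : (forall a, subgrp (E a)) -> hsum E P x ->
  exists (s : seq G) (f : G -> K),
    [/\ uniq s, forall a, a \in s -> P a /\ E a (f a) & x = \sum_(a <- s) f a].
Proof.
move=> gE [l [Hl ->]].
exists (undup (map fst l)), (fun a => \sum_(p <- l | p.1 == a) p.2); split.
- exact: undup_uniq.
- move=> a; rewrite mem_undup => /mapP [p /Hl [Pp _] ->]; split=> //.
  rewrite big_seq_cond; apply: subgrp_sum => // q /andP [/Hl [_ Eq] /eqP <-] //.
- rewrite (exchange_big_dep predT) //= big_seq [RHS]big_seq.
  apply: eq_bigr => p pl.
  rewrite [RHS]big_mkcond (bigD1_seq p.1) ?undup_uniq ?mem_undup ?map_f //= ?eqxx //.
  by rewrite big1 ?addr0 // => a ap; rewrite eq_sym (negbTE ap).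
Qed.

Lemma decomposes_hsum E x : decomposes E x -> hsum E setT x.
Proof.
move=> [s [f [us Ef ->]]]; exists [seq (a, f a) | a <- s]; split; last by rewrite big_map.
by move=> _ /mapP [a /Ef Ea ->].
Qed.

Lemma hsum_decomposes E P x : (forall a, subgrp (E a)) -> hsum E P x -> decomposes E x.
Proof.
move=> gE /(hsum_uniq gE) [s [f [us Ef ->]]]; exists s, f; split=> // a /Ef; by case.
Qed.

Definition direct E := forall (s : seq G) (f : G -> K), uniq s ->
  (forall a, a \in s -> E a (f a)) ->
  \sum_(a <- s) f a = 0 -> forall a, a \in s -> f a = 0.

Lemma hsum_disjoint E P Q x : (forall a, subgrp (E a)) -> direct E ->
  (forall a, P a -> Q a -> False) -> hsum E P x -> hsum E Q x -> x = 0.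
Proof.
move=> gE dE PQ /(hsum_uniq gE) [s [f [us Ef xs]]] /(hsum_uniq gE) [t [h [ut Eh xt]]].
have st a : a \in s -> a \in t = false.
  by move=> /Ef [Pa _]; apply/negP => /Eh [Qa _]; apply: (PQ a).
pose k a := if a \in s then f a else - h a.
have ks : {in s, k =1 f} by move=> a sa; rewrite /k sa.
have kt : {in t, k =1 (fun a => - h a)}.
  by move=> a ta; rewrite /k; case: ifP => // /st; rewrite ta.
have := dE (s ++ t) k; rewrite cat_uniq us ut andbT big_cat /=.
rewrite (eq_big_seq _ ks) -xs (eq_big_seq _ kt) sumrN -xt subrr => H.
rewrite xs big_seq big1 // => a sa; rewrite -ks //; apply: H => //.
- by apply/hasPn => b tb; apply/negP => /st; rewrite tb.
- move=> b; rewrite mem_cat => /orP [sb|tb]; first by rewrite ks //; have [] := Ef _ sb.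
  by rewrite kt //; apply: (subgrpN (gE _)); have [] := Eh _ tb.
- by rewrite mem_cat sa.
Qed.

(** This is how components of an equation are read off: x - y = y' - x' is a sum over [P] and also
    over the complement of [P]. *)
Lemma hsum_compare E P x x' y y' : (forall a, subgrp (E a)) -> direct E ->
  hsum E P x -> hsum E P y -> hsum E (fun a => ~ P a) x' -> hsum E (fun a => ~ P a) y' ->
  x + x' = y + y' -> x = y.
Proof.
move=> gE dE Px Py Px' Py' eq; apply/eqP; rewrite -subr_eq0; apply/eqP.
have gs P' := hsum_subgrp P' gE.
apply: (hsum_disjoint (P := P) (Q := fun a => ~ P a) gE dE) => //.
  exact: (subgrpB (gs _)).
have -> : x - y = y' - x'.
  by apply/eqP; rewrite subr_eq addrAC eq_sym subr_eq eq_sym addrC -eq addrC.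
exact: (subgrpB (gs _)).
Qed.

End HomogeneousSums.

(** * The Dedekind--Mertens inclusion *)

Section DedekindMertens.
Local Open Scope ring_scope.
Variable K : fieldType.
Implicit Types (P F : {poly K}) (N : set K).

Definition monom F (l : seq nat) : K := \prod_(j <- l) F`_j.

Lemma monom_cons F j l : monom F (j :: l) = F`_j * monom F l.
Proof. exact: big_cons. Qed.

Lemma monom_perm F j l : j \in l -> monom F l = F`_j * monom F (rem j l).
Proof. by move=> jl; rewrite /monom (big_rem j). Qed.

Lemma coef_mul_monomial P n (a : K) k : (P * (a *: 'X^n))`_k =
  if (k < n)%N then 0 else a * P`_(k - n).
Proof. by rewrite -scalerAr coefZ coefMXn; case: ifP; rewrite ?mulr0. Qed.

Lemma subgrp_scale (c : K) N : subgrp N -> subgrp [set z | N (c * z)].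
Proof.
move=> gN; split=> /= [|x y Nx Ny]; first by rewrite mulr0; apply: (subgrp0 gN).
by rewrite mulrBr; apply: (subgrpB gN).
Qed.

Lemma size_sub_lead P n : (size P <= n.+1)%N -> (size (P - P`_n *: 'X^n)%R <= n)%N.
Proof.
move=> sP; apply/leq_sizeP => j nj; rewrite coefB coefZ coefXn.
case: (ltngtP n j) nj => // [nj _|<- _]; last by rewrite mulr1 subrr.
by rewrite mulr0 subr0 nth_default // (leq_trans sP).
Qed.

(* The Dedekind--Mertens inclusion C(F)^(n+1) C(P) <= C(F)^n C(PF) for deg P <= n,
   with the right-hand side replaced by any additive subgroup that contains its generators. *)
Lemma dedekind_mertens n m P F N : subgrp N ->
  (size P <= n.+1)%N -> (size F <= m)%N ->
  (forall k l, size l = n -> N ((P * F)`_k * monom F l)) ->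
  forall i l, size l = n.+1 -> N (P`_i * monom F l).
Proof.
elim: n m P F N => [|n IHn] m P F N gN.
  move=> sP sF H i l sl; case: l sl => [//|j [|//]] _.
  have -> : P`_i * monom F [:: j] = if i == 0%N then (P * F)`_j * monom F [::] else 0.
    rewrite /monom big_seq1 big_nil mulr1 (size1_polyC sP) coefCM coefC.
    by case: eqP => //; rewrite mul0r.
  by case: ifP => _; [apply: H | apply: (subgrp0 gN)].
elim: m P F N gN => [|m IHm] P F N gN sP sF H i l sl.
  have -> : F = 0 by apply/eqP; rewrite -size_poly_leq0.
  by case: l sl => // j l _; rewrite monom_cons coef0 mul0r mulr0; apply: (subgrp0 gN).
pose p := P`_n.+1; pose P' := P - p *: 'X^(n.+1).
have sP' : (size P' <= n.+1)%N by exact: size_sub_lead.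
have eP k : P`_k = P'`_k + if k == n.+1 then p else 0.
  by rewrite coefB coefZ coefXn; case: eqP => [->|_]; rewrite ?mulr1 ?mulr0 ?subr0 ?addr0 ?subrK.
have top : (P * F)`_(n.+1 + m) = p * F`_m.
  rewrite coefM (bigD1 (inord n.+1)) //= inordK ?ltnS ?leq_addr // addKn.
  rewrite big1 ?addr0 // => j jn.
  case: (ltngtP (j : nat) n.+1) => [jlt|jgt|je].
  - rewrite [F`__]nth_default ?mulr0 // (leq_trans sF) //; lia.
  - by rewrite nth_default ?mul0r // (leq_trans sP).
  - by case/eqP: jn; apply/val_inj; rewrite /= inordK ?ltnS ?leq_addr.
have topN l' : size l' = n.+1 -> N (p * F`_m * monom F l').
  by move=> sl'; rewrite -top; apply: H.
have P'F k : (P' * F)`_k = (P * F)`_k - if (k < n.+1)%N then 0 else p * F`_(k - n.+1).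
  by rewrite mulrBl coefB mulrC [_ * F]mulrC coef_mul_monomial mulrC.
(* The induction on [n] applies to [P'], with [N] replaced by its preimage under multiplication by
   [c]. Passing from [P * F] to [P' * F] costs terms p F_j; they are absorbed by [topN] when c =
   F_m, and otherwise by the assumption on products of p with n+2 coefficients. *)
have step2 c l' : (c = F`_m) \/ (forall l1, size l1 = n.+2 -> N (p * monom F l1)) ->
    (exists j, c = F`_j) -> size l' = n.+1 -> forall i', N (c * (P'`_i' * monom F l')).
  move=> hc [j cj] sl' i'.
  apply: (IHn (size F) P' F [set z | N (c * z)]) => //=; first exact: subgrp_scale.
  move=> k l3 sl3; rewrite P'F mulrBl mulrBr; apply: (subgrpB gN).
    rewrite mulrCA cj -monom_cons; apply: H; by rewrite /= sl3.
  case: ifP => _; first by rewrite mul0r mulr0; apply: (subgrp0 gN).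
  case: hc => [->|hp].
    have -> : F`_m * (p * F`_(k - n.+1) * monom F l3) =
              p * F`_m * monom F ((k - n.+1)%N :: l3) by rewrite monom_cons; ring.
    by apply: topN; rewrite /= sl3.
  have -> : c * (p * F`_(k - n.+1) * monom F l3) =
            p * monom F [:: j, (k - n.+1)%N & l3] by rewrite !monom_cons cj; ring.
  by apply: hp; rewrite /= sl3.
(* A product containing F_m is covered by [topN]. In the others F may lose its top term, so the
   induction on [m] applies; the error term F_m X^m P is split along P = P' + p X^(n+1). *)
have step1 l1 : size l1 = n.+2 -> N (p * monom F l1).
  move=> sl1; have [ml|ml] := boolP (m \in l1).
    rewrite (monom_perm _ ml) mulrA; apply: topN; by rewrite size_rem // sl1.
  pose F' := F - F`_m *: 'X^m.
  have sF' : (size F' <= m)%N by exact: size_sub_lead.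
  have eF k : F'`_k = if k == m then 0 else F`_k.
    rewrite coefB coefZ coefXn; case: eqP => [->|_]; by rewrite ?mulr1 ?subrr ?mulr0 ?subr0.
  have eM l2 : monom F' l2 = if m \in l2 then 0 else monom F l2.
    case: ifP => m2; first by rewrite (monom_perm _ m2) eF eqxx mul0r.
    apply: eq_big_seq => k kl; rewrite eF; case: eqP => // km; by rewrite -km kl in m2.
  have := IHm P F' N gN sP sF'; rewrite /p => {}IHm.
  have := IHm _ n.+1 l1 sl1; rewrite eM (negbTE ml); apply=> k l2 sl2.
  rewrite eM; case: ifP => m2; first by rewrite mulr0; apply: (subgrp0 gN).
  rewrite mulrBr coefB coef_mul_monomial mulrBl; apply: (subgrpB gN); first exact: H.
  case: ifP => _; first by rewrite mul0r; apply: (subgrp0 gN).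
  rewrite eP mulrDr mulrDl; apply: (subgrpD gN).
    by rewrite -mulrA; apply: step2 => //; [left | exists m].
  case: ifP => _; last by rewrite mulr0 mul0r; apply: (subgrp0 gN).
  by rewrite [F`_m * p]mulrC; apply: topN.
rewrite eP mulrDl; apply: (subgrpD gN).
  case: l sl => // j l [sl]; rewrite monom_cons mulrCA.
  by apply: step2 => //; [right | exists j].
case: ifP => _; first exact: step1.
by rewrite mul0r; apply: (subgrp0 gN).
Qed.

End DedekindMertens.

(** * The Euclidean algorithm for graded polynomials *)

Section GradedEuclid.
Local Open Scope ring_scope.
Variables (K : fieldType) (G : zmodType) (Q : G -> set K) (g : G).
Hypothesis gQ : forall e, subgrp (Q e).
Hypothesis Q1 : Q 0 1.
Hypothesis QM : forall e e' x y, Q e x -> Q e' y -> Q (e + e') (x * y).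
Hypothesis QV : forall e x, Q e x -> Q (- e) x^-1.
Implicit Types P U D : {poly K}.

(* [P.[1]] is the graded element of interest: the variable of [P] only records degrees, and the
   coefficient [P`_i] is the part of degree [g *+ i + c]. *)
Definition gpoly c P := forall i, Q (g *+ i + c) P`_i.

Lemma gpoly0 c : gpoly c 0.
Proof. by move=> i; rewrite coef0; apply: (subgrp0 (gQ _)). Qed.

Lemma gpolyD c P P' : gpoly c P -> gpoly c P' -> gpoly c (P + P').
Proof. by move=> gP gP' i; rewrite coefD; apply: (subgrpD (gQ _)). Qed.

Lemma gpolyM c c' P P' : gpoly c P -> gpoly c' P' -> gpoly (c + c') (P * P').
Proof.
move=> gP gP' i; rewrite coefM; apply: (subgrp_sum (gQ _)) => j _.
have -> : g *+ i + (c + c') = (g *+ j + c) + (g *+ (i - j) + c').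
  by rewrite addrACA -mulrnDr subnKC // -ltnS.
exact: QM.
Qed.

Lemma gpoly_monomial e k x : Q e x -> gpoly (e - g *+ k) (x *: 'X^k).
Proof.
move=> Qx i; rewrite coefZ coefXn; case: eqP => [->|_].
  by rewrite mulr1 addrCA subrr addr0.
by rewrite mulr0; apply: (subgrp0 (gQ _)).
Qed.

Lemma gpoly1 : gpoly 0 1.
Proof.
move=> i; rewrite coef1; case: eqP => [->|_]; first by rewrite mulr0n addr0.
exact: (subgrp0 (gQ _)).
Qed.

Definition graded_ideal (N : set {poly K}) : Prop :=
  (forall P P', N P -> N P' -> N (P + P')) /\
  (forall c U P, gpoly c U -> N P -> N (U * P)).

Definition gdvd D P := exists c P1, gpoly c P1 /\ P = P1 * D.

(** Nonzero elements of the [Q e] have homogeneous inverses, so a graded multiple of the shorter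
    polynomial cancels the leading term of the longer one; the induction is on the sum of the sizes.
    Membership of [D] in every [graded_ideal] containing both polynomials replaces a Bezout
    identity. *)
Lemma graded_gcd P1 P2 c1 c2 : gpoly c1 P1 -> gpoly c2 P2 ->
  exists D c d1 d2 E1 E2, [/\ gpoly c D, gpoly d1 E1 /\ d1 + c = c1, gpoly d2 E2 /\ d2 + c = c2,
    P1 = E1 * D /\ P2 = E2 * D &
    forall N, graded_ideal N -> N P1 -> N P2 -> N D].
Proof.
have [k] := ubnP (size P1 + size P2); elim: k P1 P2 c1 c2 => // k IH P1 P2 c1 c2.
wlog s12 : P1 P2 c1 c2 / (size P1 <= size P2)%N => [H|] sk g1 g2.
  have [s12|s21] := leqP (size P1) (size P2); first exact: H.
  have [] := H P2 P1 c2 c1 (ltnW s21) _ g2 g1; first by rewrite addnC.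
  move=> D [c [d2 [d1 [E2 [E1 [gD e2 e1 [eP2 eP1] ND]]]]]].
  by exists D, c, d1, d2, E1, E2; split=> // N *; apply: ND.
have [P10|P1n0] := eqVneq P1 0.
  exists P2, c2, (c1 - c2), 0, 0, 1; split=> //.
  - by rewrite subrK; split=> //; apply: gpoly0.
  - by rewrite add0r; split=> //; apply: gpoly1.
  - by rewrite mul0r mul1r.
have s1 : (0 < size P1)%N by rewrite lt0n size_poly_eq0.
pose m := lead_coef P2 / lead_coef P1; pose d := (size P2 - size P1)%N.
pose M : {poly K} := m *: 'X^d; pose P3 := P2 - M * P1.
have gM : gpoly (c2 - c1) M.
  have Qm := QM (g2 (size P2).-1) (QV (g1 (size P1).-1)).
  have -> : c2 - c1 = (g *+ (size P2).-1 + c2 - (g *+ (size P1).-1 + c1)) - g *+ d.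
    rewrite opprD addrACA -mulrnBr; last by lia.
    have -> : ((size P2).-1 - (size P1).-1 = d)%N by rewrite /d; lia.
    by rewrite addrAC subrr add0r.
  exact: gpoly_monomial.
have g3 : gpoly c2 P3.
  move=> i; rewrite coefB; apply: (subgrpB (gQ _)) => //.
  have := gpolyM gM g1 i; by rewrite subrK.
have s3 : (size P3 < size P2)%N.
  have s2 : size P2 = (size P2).-1.+1 by rewrite prednK // (leq_trans s1).
  rewrite {1}s2 ltnS; apply/leq_sizeP => j; rewrite leq_eqVlt => /orP [/eqP <-|jl].
    rewrite coefB -[M * P1]mulrC coef_mul_monomial.
    have -> : ((size P2).-1 < d)%N = false by rewrite /d; lia.
    have -> : ((size P2).-1 - d = (size P1).-1)%N by rewrite /d; lia.
    by rewrite -!lead_coefE /m divfK ?lead_coef_eq0 // subrr.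
  rewrite coefB -[M * P1]mulrC coef_mul_monomial.
  rewrite [P2`_j]nth_default; last by exact: leq_trans (leqSpred _) jl.
  case: ifP => _; first by rewrite subr0.
  rewrite [X in _ * X]nth_default ?mulr0 ?subr0 //.
  by rewrite -{1}(subKn s12) leq_sub2r // (leq_trans (leqSpred _) jl).
have [] := IH P1 P3 c1 c2 _ g1 g3; first by lia.
move=> D [c [d1 [d2 [E1 [E3 [gD [gE1 e1] [gE3 e3] [eP1 eP3] ND]]]]]].
have P2E : P2 = M * P1 + P3 by rewrite /P3 addrC subrK.
exists D, c, d1, d2, E1, (M * E1 + E3); split=> //.
- split=> //; apply: gpolyD => //.
  have -> : d2 = (c2 - c1) + d1; last exact: gpolyM.
  by rewrite -e3 -e1 opprD addrACA subrr addr0 subrK.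
- by split=> //; rewrite P2E {1}eP1 {1}eP3 mulrA mulrDl.
- move=> N iN N1 N2; apply: ND => //; case: iN => ND NM.
  have -> : P3 = P2 + (- M) * P1 by rewrite /P3 mulNr.
  apply: ND => //; apply: (NM (c2 - c1)) => //.
  by move=> i; rewrite coefN; apply: (subgrpN (gQ _)).
Qed.

Lemma graded_gcd_seq (s : seq {poly K}) : (forall P, P \in s -> exists c, gpoly c P) ->
  exists D c, [/\ gpoly c D, forall P, P \in s -> gdvd D P &
    forall N, graded_ideal N -> N 0 -> (forall P, P \in s -> N P) -> N D].
Proof.
elim: s => [|P s IH] gs.
  by exists 0, 0; split=> //; apply: gpoly0.
have [|D [c [gD dD ND]]] := IH; first by move=> P' Ps; apply: gs; rewrite inE Ps orbT.
have [|c' gP] := gs P; first by rewrite inE eqxx.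
have [D' [c1 [d1 [d2 [E1 [E2 [gD' [gE1 _] [gE2 _] [eP eD] ND']]]]]]] := graded_gcd gP gD.
exists D', c1; split=> // [P'|N iN N0 Ns].
  rewrite inE => /orP [/eqP ->|/dD [c2 [P1 [gP1 ->]]]].
    by exists d1, E1.
  exists (c2 + d2), (P1 * E2); split; first exact: gpolyM.
  by rewrite -mulrA -eD.
apply: ND' => //; first by apply: Ns; rewrite inE eqxx.
by apply: ND => // P' Ps; apply: Ns; rewrite inE Ps orbT.
Qed.

End GradedEuclid.

(** * From homogeneous to arbitrary finitely generated ideals *)

Section HomogeneousInvertibility.
Local Open Scope ring_scope.
Variables (K : fieldType) (G : zmodType).

Definition graded_subring (A : G -> set K) (T : set K) : Prop :=
  [/\ (forall a, subgrp (A a)) /\ A 0 1,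
      (forall a b x y, A a x -> A b y -> A (a + b) (x * y)),
      direct A, is_subring T &
      forall x, T x -> hsum (fun a => T `&` A a) setT x].

(* [t]-invertibility of the fractional ideal I generated by [s]: the list [u] lies in (T : I), and
   the second clause says that the finitely generated ideal I u has [v]-closure [T]. *)
Definition tinv (T : set K) (s : seq K) : Prop :=
  exists u : seq K, (forall a b, a \in s -> b \in u -> T (a * b)) /\
    forall x, (forall a b, a \in s -> b \in u -> T (x * (a * b))) -> T x.

Lemma is_subring_subgrp (T : set K) : is_subring T -> subgrp T.
Proof. by case. Qed.

Lemma is_subringM (T : set K) x y : is_subring T -> T x -> T y -> T (x * y).
Proof. by case=> _ _ _; apply. Qed.

Lemma is_subring1 (T : set K) : is_subring T -> T 1.
Proof. by case. Qed.

Lemma is_subringX (T : set K) x n : is_subring T -> T x -> T (x ^+ n).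
Proof.
move=> rT Tx; elim: n => [|n IH]; first by rewrite expr0; apply: is_subring1.
by rewrite exprS; apply: is_subringM.
Qed.

Variables (A : G -> set K) (T : set K).
Hypothesis gAT : graded_subring A T.

Let E a := T `&` A a.

Let rT : is_subring T. Proof. by case: gAT. Qed.
Let gT : subgrp T. Proof. exact: is_subring_subgrp. Qed.

Let gE a : subgrp (E a).
Proof.
case: gAT => [[gA _] _ _ _ _]; split=> [|x y [Tx Ax] [Ty Ay]].
  by split; [apply: (subgrp0 gT) | apply: (subgrp0 (gA a))].
by split; [apply: (subgrpB gT) | apply: (subgrpB (gA a))].
Qed.

Let EM a b x y : E a x -> E b y -> E (a + b) (x * y).
Proof.
case: gAT => [_ AM _ _ _] [Tx Ax] [Ty Ay]; split; [exact: is_subringM | exact: AM].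
Qed.

Let E1 : E 0 1.
Proof. by case: gAT => [[_ A1] _ _ _ _]; split=> //; apply: is_subring1. Qed.

Let dE : direct E.
Proof. by case: gAT => [_ _ dA _ _] s f us Ef; apply: dA => // a /Ef []. Qed.

Let TE x : T x -> hsum E setT x.
Proof. by case: gAT => [_ _ _ _]; apply. Qed.

(* The multiplier [N] makes these classes closed under adjoining to [S] an element that has a
   nonzero multiple in [S], so that [G / S] need not be torsion-free. *)
Definition modhom (S : set G) N e : set K := hsum E [set a | S (a *+ N - e)].

Let gM S N e : subgrp (modhom S N e). Proof. exact: hsum_subgrp. Qed.

Let modhomT S N e x : modhom S N e x -> T x.
Proof. by move: x; apply: hsum_subset => // a _ x []. Qed.

Lemma modhomM S N e e' x y : subgrp S ->
  modhom S N e x -> modhom S N e' y -> modhom S N (e + e') (x * y).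
Proof.
move=> gS; apply: hsumM => // a b /= Sa Sb.
by rewrite mulrnDl opprD addrACA; apply: subgrpD.
Qed.

Lemma modhom1 S N : subgrp S -> modhom S N 0 1.
Proof.
move=> gS; apply: (hsum_homog (a := 0)); first exact: E1.
by rewrite /= mul0rn subr0; apply: subgrp0.
Qed.

Definition hom_mod S x := exists N e, (0 < N)%N /\ modhom S N e x.

(** The statement carried along the chain of subgroups: for S = 0 it amounts, by torsion-freeness,
    to the hypothesis on homogeneous elements, and it covers every list of elements of [T] whose
    degrees lie in [S]. *)
Definition hom_tinv S := forall s : seq K, (forall x, x \in s -> hom_mod S x) ->
  (exists2 x, x \in s & x != 0) -> tinv T s.

Definition adjoin (S : set G) g : set G := [set a | exists m : int, S (a - g *~ m)].

Lemma adjoin_subgrp S g : subgrp S -> subgrp (adjoin S g).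
Proof.
move=> gS; split=> [|x y [m Sm] [n Sn]]; first by exists 0; rewrite mulr0z subr0; apply: subgrp0.
exists (m - n).
have -> : x - y - g *~ (m - n) = (x - g *~ m) - (y - g *~ n).
  rewrite mulrzBr !opprB addrACA [RHS]addrACA; congr (_ + _); exact: addrC.
exact: subgrpB.
Qed.

Lemma sub_adjoin S g a : S a -> adjoin S g a.
Proof. by move=> Sa; exists 0; rewrite mulr0z subr0. Qed.

(** * Adjoining a degree with no positive multiple in the subgroup *)

Section OneStep.
Variables (S : set G) (g : G).
Hypothesis gS : subgrp S.
Hypothesis indep : forall n, ~ S (g *+ n.+1).
Hypothesis tinvS : hom_tinv S.

Let S' := adjoin S g.

Let subgrpS' : subgrp S'. Proof. exact: adjoin_subgrp. Qed.

Let subS' a : S a -> S' a. Proof. exact: sub_adjoin. Qed.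

Let adjoined i : S' (g *+ i).
Proof. by exists i%:Z; rewrite -pmulrn subrr; apply: subgrp0. Qed.

Lemma indep_inj i j : S (g *+ i - g *+ j) -> i = j.
Proof.
wlog ij : i j / (j <= i)%N => [H Sij|].
  have [ji|/ltnW ij] := leqP j i; first exact: H.
  by symmetry; apply: H => //; rewrite -opprB; apply: subgrpN.
rewrite -mulrnBr //; case: (posnP (i - j)) => [|/prednK <- /indep //].
by move/eqP; rewrite subn_eq0 => ji; move=> _; apply/eqP; rewrite eqn_leq ji ij.
Qed.

Section FixedMultiplier.
Variable N : nat.

Let modS'_of c i x : modhom S N (g *+ i + c) x -> modhom S' N c x.
Proof.
apply: hsum_mono => // a /= Sa0; have Sa := subS' Sa0.
have -> : a *+ N - c = (a *+ N - (g *+ i + c)) + g *+ i by rewrite opprD addrA [RHS]addrAC subrK.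
exact: (subgrpD subgrpS' Sa (adjoined i)).
Qed.

Let gpoly_of_list c (l : seq (G * K)) :
  (forall p, p \in l -> E p.1 p.2 /\ exists i, S (p.1 *+ N - (g *+ i + c))) ->
  exists P, gpoly (modhom S N) g c P /\ P.[1] = \sum_(p <- l) p.2.
Proof.
elim: l => [|p l IH] Hl.
  exists 0; split; first by apply: gpoly0.
  by rewrite big_nil horner0.
have [|P [gP eP]] := IH; first by move=> q ql; apply: Hl; rewrite inE ql orbT.
have [Ep [i Si]] := Hl p (mem_head _ _).
exists (P + p.2 *: 'X^i); split; last first.
  by rewrite hornerD eP hornerZ hornerXn expr1n mulr1 big_cons addrC.
apply: gpolyD => // k; rewrite coefZ coefXn; case: eqP => [->|_]; last first.
  by rewrite mulr0; apply: (subgrp0 (gM _ _ _)).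
by rewrite mulr1; apply: (hsum_homog Ep).
Qed.

Let modS'_poly e x : modhom S' N e x ->
  exists c P, gpoly (modhom S N) g c P /\ P.[1] = x.
Proof.
move=> [l [Hl ->]].
(* The multiples of [g] that occur may be negative; lowering the base degree by [g *+ M] for a large
   [M] turns all exponents into natural numbers. *)
suff [M HM] : exists M, forall p, p \in l ->
    exists i, S (p.1 *+ N - (g *+ i + (e - g *+ M))).
  exists (e - g *+ M); apply: gpoly_of_list => p pl; split; last exact: HM.
  by have [] := Hl _ pl.
elim: l Hl => [|p l IH] Hl; first by exists 0.
have [|M HM] := IH; first by move=> q ql; apply: Hl; rewrite inE ql orbT.
have [[m Sm] _] := Hl p (mem_head _ _).
have [i [M0 em]] : exists i M0 : nat, m = i%:Z - M0%:Z.
  case: m {Sm} => n; first by exists n, 0%N; rewrite subr0.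
  by exists 0%N, n.+1; rewrite NegzE sub0r.
exists (M0 + M)%N => q; rewrite inE => /orP [/eqP ->|/HM [j Sj]].
  exists (i + M)%N; move: Sm; rewrite em mulrzBr -!pmulrn !mulrnDr.
  congr S; rewrite -addrA -opprD; congr (_ - _).
  by rewrite opprD addrACA [e + _]addrC [g *+ M + _]addrC addrA addrA subrK addrAC.
exists (j + M0)%N.
have -> : g *+ (j + M0) + (e - g *+ (M0 + M)) = g *+ j + (e - g *+ M); last exact: Sj.
rewrite !mulrnDr opprD.
by rewrite -[LHS]addrA; congr (_ + _); rewrite [LHS]addrCA addNKr.
Qed.

(** Quotients of S-homogeneous elements, graded by the difference of the degrees: every nonzero one
    is invertible, as Euclidean division needs. In [locS] the numerator is an arbitrary element of
    [T]. *)
Definition fracS e : set K := [set z | exists e1 e2 y h,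
  [/\ modhom S N e1 y, modhom S N e2 h, h != 0, e = e1 - e2 & z = y / h]].

Definition locS : set K := [set x | exists e y h,
  [/\ T y, modhom S N e h, h != 0 & x = y / h]].

Let fracS_subgrp e : subgrp (fracS e).
Proof.
split=> [|x y].
  exists e, 0, 0, 1; split; rewrite ?oner_neq0 ?subr0 ?mul0r //.
    exact: (subgrp0 (gM _ _ _)).
  exact: modhom1.
move=> [e1 [e2 [y1 [h1 [My1 Mh1 h1n0 ee ->]]]]] [e3 [e4 [y2 [h2 [My2 Mh2 h2n0 ee' ->]]]]].
exists (e1 + e4), (e2 + e4), (y1 * h2 - y2 * h1), (h1 * h2); split.
- apply: (subgrpB (gM _ _ _)); first exact: modhomM.
  have -> : e1 + e4 = e3 + e2 by rewrite -[e1](subrK e2) -ee ee' addrAC subrK.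
  exact: modhomM.
- exact: modhomM.
- by rewrite mulf_neq0.
- by rewrite opprD addrACA subrr addr0.
- by field; rewrite h1n0 h2n0.
Qed.

Let fracS1 : fracS 0 1.
Proof.
by exists 0, 0, 1, 1; split; rewrite ?oner_neq0 ?subr0 ?divr1 //; apply: modhom1.
Qed.

Let fracSM e e' x y : fracS e x -> fracS e' y -> fracS (e + e') (x * y).
Proof.
move=> [e1 [e2 [y1 [h1 [My1 Mh1 h1n0 -> ->]]]]] [e3 [e4 [y2 [h2 [My2 Mh2 h2n0 -> ->]]]]].
exists (e1 + e3), (e2 + e4), (y1 * y2), (h1 * h2); split; try exact: modhomM.
- by rewrite mulf_neq0.
- by rewrite opprD addrACA.
- by field; rewrite h1n0 h2n0.
Qed.

Let fracSV e x : fracS e x -> fracS (- e) x^-1.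
Proof.
move=> [e1 [e2 [y [h [My Mh hn0 -> ->]]]]].
have [->|yn0] := eqVneq y 0.
  by rewrite mul0r invr0; apply: (subgrp0 (fracS_subgrp _)).
exists e2, e1, h, y; split=> //; first by rewrite opprB.
by rewrite invf_div.
Qed.

Let modhom_fracS e x : modhom S N e x -> fracS e x.
Proof.
exists e, 0, x, 1; split; rewrite ?oner_neq0 ?subr0 ?divr1 //; exact: modhom1.
Qed.

Let locSD x y : locS x -> locS y -> locS (x + y).
Proof.
move=> [e1 [y1 [h1 [Ty1 Mh1 h1n0 ->]]]] [e2 [y2 [h2 [Ty2 Mh2 h2n0 ->]]]].
exists (e1 + e2), (y1 * h2 + y2 * h1), (h1 * h2); split.
- apply: (subgrpD gT); apply: (is_subringM rT) => //; [exact: modhomT Mh2 | exact: modhomT Mh1].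
- exact: modhomM.
- by rewrite mulf_neq0.
- by field; rewrite h1n0 h2n0.
Qed.

Let locSM x y : locS x -> locS y -> locS (x * y).
Proof.
move=> [e1 [y1 [h1 [Ty1 Mh1 h1n0 ->]]]] [e2 [y2 [h2 [Ty2 Mh2 h2n0 ->]]]].
exists (e1 + e2), (y1 * y2), (h1 * h2); split.
- exact: (is_subringM rT).
- exact: modhomM.
- by rewrite mulf_neq0.
- by field; rewrite h1n0 h2n0.
Qed.

Let T_locS x : T x -> locS x.
Proof.
by exists 0, x, 1; split; rewrite ?oner_neq0 ?divr1 //; apply: modhom1.
Qed.

Let locS_eval c P : gpoly fracS g c P -> locS P.[1].
Proof.
move=> gP; rewrite horner_coef; apply: (big_ind locS) => //.
  by apply: T_locS; apply: subgrp0.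
move=> i _; rewrite expr1n mulr1; have [e1 [e2 [y [h [My Mh hn0 _ ->]]]]] := gP i.
by exists e2, y, h; split=> //; apply: modhomT My.
Qed.

Lemma common_denominator (l : seq (G * K)) : (forall p, p \in l -> fracS p.1 p.2) ->
  exists e h, [/\ modhom S N e h, h != 0 &
    forall p, p \in l -> modhom S N (e + p.1) (h * p.2)].
Proof.
elim: l => [|p l IH] Hl.
  by exists 0, 1; split; rewrite ?oner_neq0 //; apply: modhom1.
have [|e [h [Mh hn0 Hh]]] := IH; first by move=> q ql; apply: Hl; rewrite inE ql orbT.
have [e1 [e2 [y [k [My Mk kn0 ep pE]]]]] := Hl p (mem_head _ _).
exists (e + e2), (h * k); split; [exact: modhomM | by rewrite mulf_neq0 |].
move=> q; rewrite inE => /orP [/eqP ->|/Hh Mq].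
  have -> : h * k * p.2 = h * y by rewrite pE; field.
  have -> : e + e2 + p.1 = e + e1 by rewrite ep addrAC -addrA subrK.
  exact: modhomM.
by rewrite addrAC mulrAC; apply: modhomM.
Qed.

Lemma common_denominator_poly (l : seq {poly K}) :
  (forall P, P \in l -> exists c, gpoly fracS g c P) ->
  exists e h, [/\ modhom S N e h, h != 0 &
    forall P, P \in l -> exists c, gpoly (modhom S N) g c (h *: P)].
Proof.
elim: l => [|P l IH] Hl.
  by exists 0, 1; split; rewrite ?oner_neq0 //; apply: modhom1.
have [|e [h [Mh hn0 Hh]]] := IH; first by move=> q ql; apply: Hl; rewrite inE ql orbT.
have [c gP] := Hl P (mem_head _ _).
have [|e1 [k [Mk kn0 Hk]]] :=
  common_denominator (l := [seq (g *+ i + c, P`_i) | i <- iota 0 (size P)]).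
  by move=> _ /mapP [i _ ->]; apply: gP.
exists (e + e1), (h * k); split; [exact: modhomM | by rewrite mulf_neq0 |].
move=> Q; rewrite inE => /orP [/eqP ->|/Hh [c1 gQ]].
  exists (e + e1 + c) => i; rewrite coefZ.
  have [iP|Pi] := ltnP i (size P); last first.
    by rewrite nth_default // mulr0; apply: (subgrp0 (gM _ _ _)).
  have -> : g *+ i + (e + e1 + c) = e + (e1 + (g *+ i + c)) by rewrite addrCA -addrA addrCA !addrA.
  rewrite -mulrA; apply: modhomM => //.
  by apply: (Hk (g *+ i + c, P`_i)); apply/mapP; exists i; rewrite // mem_iota.
exists (e1 + c1) => i; rewrite mulrC -scalerA coefZ addrCA.
by apply: modhomM.
Qed.

Let tuples m n : seq (seq nat) :=
  iter n (fun ls => [seq i :: l | i <- iota 0 m, l <- ls]) [:: [::]].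

Let mem_tuples m n l : (l \in tuples m n) = (size l == n) && all (fun i => (i < m)%N) l.
Proof.
elim: n l => [|n IH] l /=; first by rewrite inE; case: l.
apply/allpairsP/idP => [[[i k] /= [im kn ->]]|].
  rewrite /= eqSS; move: im kn; rewrite mem_iota IH /= => -> /andP [-> ->]; by [].
case: l => [//|i l] /=; rewrite eqSS => /and3P [sl im al].
by exists (i, l); rewrite /= mem_iota IH sl al.
Qed.

(** Write y = Y.[1]. Comparing components shows that the coefficients of Y F lie in h T. By
    Dedekind--Mertens, Y_i times the (n+1)-st power of the content of F lies in h T times the n-th
    power, and the t-invertibility of the n-th power cancels it. *)
Let gauss_homogeneous c F e' h e y : gpoly (modhom S N) g c F -> (0 < N)%N ->
  modhom S N e' h -> h != 0 -> modhom S' N e y ->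
  T (y / h * F.[1]) -> forall j, T (y / h * F`_j).
Proof.
move=> gF N0 Mh hn0 /modS'_poly [c1 [Y [gY eY]]] Tz.
have gYF : gpoly (modhom S N) g (c1 + c) (Y * F).
  by apply: gpolyM => // *; apply: modhomM.
(* Distinct exponents give distinct degree classes modulo [S] by [indep_inj]. So (Y F)_k is the part
   of h z in the class of [kappa], where z = y / h * F.[1]; it equals h times a part of z, which
   lies in [T] because [T] is graded. *)
have Tcoef k : T ((Y * F)`_k / h).
  have [ks|sk] := ltnP k (size (Y * F)); last first.
    by rewrite nth_default // mul0r; apply: subgrp0.
  pose kappa := g *+ k + (c1 + c).
  have [z1 [z2 [Hz1 Hz2 ez]]] := hsum_split [set a | S (a *+ N - (kappa - e'))] (TE Tz).
  have Tz1 : T z1 by apply: (hsum_subset gT _ Hz1) => a _ x [].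
  suff -> : (Y * F)`_k = h * z1 by rewrite mulrC mulKf.
  apply: (hsum_compare (P := [set a | S (a *+ N - kappa)])
    (x' := \sum_(i < size (Y * F) | i != k :> nat) (Y * F)`_i) (y' := h * z2) gE dE).
  - exact: gYF.
  - apply: (hsumM EM _ Mh Hz1) => a b /= Sa [_ Sb].
    have -> : (a + b) *+ N - kappa = (a *+ N - e') + (b *+ N - (kappa - e')).
      by rewrite mulrnDl addrACA -opprD [e' + _]addrC subrK.
    exact: subgrpD.
  - apply: (subgrp_sum (hsum_subgrp _ gE)) => i ik.
    apply: hsum_mono (gYF i) => // a /= Sa Sk; case/eqP: ik.
    apply: indep_inj; have := subgrpB gS Sk Sa.
    by rewrite opprB addrC addrA subrK opprD addrACA subrr addr0.
  - apply: (hsumM EM _ Mh Hz2) => a b /= Sa [_ Sb] Sab; apply: Sb.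
    have -> : b *+ N - (kappa - e') = ((a + b) *+ N - kappa) - (a *+ N - e').
      apply/esym/eqP; rewrite subr_eq; apply/eqP.
      by rewrite addrACA -opprD subrK mulrnDl [a *+ N + _]addrC.
    exact: subgrpB.
  - rewrite -mulrDr -ez -eY.
    have -> : h * (Y.[1] / h * F.[1]) = (Y * F).[1] by rewrite hornerM; field.
    rewrite horner_coef [RHS](bigD1 (Ordinal ks)) //= expr1n mulr1; congr (_ + _).
    by apply: eq_bigr => i _; rewrite expr1n mulr1.
have [->|Fn0] := eqVneq F 0; first by move=> j; rewrite coef0 mulr0; apply: subgrp0.
(* [Ms] generates the n-th power of the content of F and consists of S-homogeneous elements, so
   [tinvS] covers it. With n = size Y the bound of [dedekind_mertens] holds, also for Y = 0. *)
pose n := size Y; pose Ms := [seq monom F l | l <- tuples (size F) n].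
have [u [uT uU]] : tinv T Ms.
  apply: tinvS.
    move=> _ /mapP [l _ ->]; exists N.
    elim: l => [|i l [e1 [_ IH]]].
      by exists 0; split=> //; rewrite /monom big_nil; apply: modhom1.
    exists (g *+ i + c + e1); split=> //; rewrite monom_cons; exact: modhomM.
  exists (monom F (nseq n (size F).-1)).
    apply: map_f; rewrite mem_tuples size_nseq eqxx all_nseq; apply/orP; right.
    by rewrite prednK // size_poly_gt0.
  rewrite prodf_seq_neq0; apply/allP => i /nseqP [-> _] /=.
  by rewrite -lead_coefE lead_coef_eq0.
move=> j.
have key i l : size l = n.+1 -> forall b, b \in u -> T (Y`_i * monom F l * (b / h)).
  move=> sl b bu.
  apply: (@dedekind_mertens _ n (size F) Y F [set z | T (z * (b / h))]) => //.
  - split=> /= [|x x' Tx Tx']; first by rewrite mul0r; apply: subgrp0.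
    by rewrite mulrBl; apply: subgrpB.
  move=> k l' sl' /=.
  have -> : (Y * F)`_k * monom F l' * (b / h) = (Y * F)`_k / h * (monom F l' * b) by ring.
  apply: (is_subringM rT) => //.
  have [al|] := boolP (all (fun i => (i < size F)%N) l').
    apply: uT => //; apply: map_f; by rewrite mem_tuples sl' eqxx.
  case/allPn => k' kl; rewrite -leqNgt => Fk.
  rewrite (monom_perm _ kl) nth_default // !mul0r; exact: subgrp0.
rewrite -eY horner_coef !mulr_suml; apply: (subgrp_sum gT) => i _; rewrite expr1n mulr1.
apply: uU => _ b /mapP [l ln ->] bu.
have -> : Y`_i / h * F`_j * (monom F l * b) = Y`_i * monom F (j :: l) * (b / h).
  by rewrite monom_cons; ring.
by apply: key => //; move: ln; rewrite mem_tuples /= => /andP [/eqP ->].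
Qed.

Let modS'_gpoly c F : gpoly (modhom S N) g c F -> modhom S' N c F.[1].
Proof.
move=> gF; rewrite horner_coef; apply: (subgrp_sum (gM _ _ _)) => i _.
by rewrite expr1n mulr1; apply: modS'_of (gF i).
Qed.

Let modSS' e x : modhom S N e x -> modhom S' N e x.
Proof. by apply: hsum_mono => a /= Sa; apply: subS' Sa. Qed.

(** The terms of x are grouped by their degrees modulo [S']. Comparing components shows that the
    group of the first term, divided by h, still multiplies F.[1] into [T]. That group is settled by
    [gauss_homogeneous], the rest by induction on the number of terms. *)
Let gauss c F e h x : gpoly (modhom S N) g c F -> (0 < N)%N ->
  modhom S N e h -> h != 0 -> T x ->
  T (x / h * F.[1]) -> forall j, T (x / h * F`_j).
Proof.
move=> gF N0 Mh hn0 /TE [l [Hl ->]] {x}.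
have [k] := ubnP (size l); elim: k l Hl => // k IH l Hl.
case: l Hl => [|p l'] Hl; first by move=> _ _ j; rewrite big_nil !mul0r; apply: subgrp0.
set l := p :: l' in Hl *; rewrite ltnS => sl Tz.
pose Pr (q : G * K) := `[< S' (q.1 *+ N - p.1 *+ N) >].
have eE (Q : pred (G * K)) : forall q, q \in [seq q <- l | Q q] -> setT q.1 /\ E q.1 q.2.
  by move=> q; rewrite mem_filter => /andP [_ /Hl].
pose y1 := \sum_(q <- [seq q <- l | Pr q]) q.2.
pose y2 := \sum_(q <- [seq q <- l | ~~ Pr q]) q.2.
have ey : \sum_(q <- l) q.2 = y1 + y2 by rewrite /y1 /y2 !big_filter (bigID Pr).
rewrite ey in Tz *.
have Hy1 : modhom S' N (p.1 *+ N) y1.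
  exists [seq q <- l | Pr q]; split=> // q qs; split; last by have [] := eE _ q qs.
  by move: qs; rewrite mem_filter => /andP [/asboolP].
have Hy2 : hsum E [set a | ~ S' (a *+ N - p.1 *+ N)] y2.
  exists [seq q <- l | ~~ Pr q]; split=> // q qs; split; last by have [] := eE _ q qs.
  by move: qs; rewrite mem_filter => /andP [/asboolPn].
set w := F.[1] in Tz; have Mw : modhom S' N c w by apply: modS'_gpoly.
pose kappa := p.1 *+ N + c.
have [z1 [z2 [Hz1 Hz2 ez]]] := hsum_split [set a | S' (a *+ N - (kappa - e))] (TE Tz).
have Tz1 : T z1 by apply: (hsum_subset gT _ Hz1) => a _ x [].
have Tz2 : T z2 by apply: (hsum_subset gT _ Hz2) => a _ x [].
have degB (a b c1 c2 : G) : (a + b) *+ N - (c1 + c2) = (a *+ N - c1) + (b *+ N - c2).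
  by rewrite mulrnDl opprD addrACA.
have kE : kappa = e + (kappa - e) by rewrite addrC subrK.
have eyw : y1 * w + y2 * w = h * z1 + h * z2.
  by rewrite -mulrDl -mulrDr -ez; field.
have e1 : y1 * w = h * z1.
  apply: (hsum_compare (P := [set a | S' (a *+ N - kappa)]) gE dE _ _ _ _ eyw).
  - exact: modhomM.
  - apply: (hsumM EM _ (modSS' Mh) Hz1) => a b /= Sa [_ Sb].
    by rewrite kE degB; apply: (subgrpD subgrpS').
  - apply: (hsumM EM _ Hy2 Mw) => a b /= Sa Sb Sab; apply: Sa.
    by move: (subgrpB subgrpS' Sab Sb); rewrite /kappa degB addrK.
  - apply: (hsumM EM _ (modSS' Mh) Hz2) => a b /= Sa [_ Sb] Sab; apply: Sb.
    by move: (subgrpB subgrpS' Sab Sa); rewrite {1}kE degB addrC addKr.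
have e2 : y2 * w = h * z2 by apply: (addrI (y1 * w)); rewrite eyw e1.
have T1 : T (y1 / h * w) by rewrite mulrAC e1 [h * _]mulrC mulfK.
have T2 : T (y2 / h * w) by rewrite mulrAC e2 [h * _]mulrC mulfK.
move=> j; rewrite !mulrDl; apply: (subgrpD gT).
  exact: (gauss_homogeneous gF N0 Mh hn0 Hy1 T1).
apply: IH => //; first by move=> q /eE.
apply: leq_trans sl; rewrite /l /= /Pr subrr.
by rewrite asboolT ?ltnS ?size_filter ?count_size //; apply: (subgrp0 subgrpS').
Qed.

(** Each entry of [s] is the value at 1 of a product psi D, with D a common divisor computed over
    [fracS]. Dividing by D.[1] and multiplying by a denominator h turns the entries into values
    F.[1] of polynomials with coefficients in [T]. An inverse for all these coefficients also works
    for the values, because [gauss] passes from values to coefficients. *)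
Lemma tinv_fixed_multiplier (s : seq K) : (0 < N)%N ->
  (forall x, x \in s -> exists e, modhom S' N e x) ->
  (exists2 x, x \in s & x != 0) -> tinv T s.
Proof.
move=> N0 Ms [x0 sx0 x0n0].
have [phi phiP] : {phi : K -> {poly K} & forall x, x \in s ->
    (exists c, gpoly (modhom S N) g c (phi x)) /\ (phi x).[1] = x}.
  apply: (choice (P := fun x P => x \in s ->
    (exists c, gpoly (modhom S N) g c P) /\ P.[1] = x)) => x.
  have [/Ms [e /modS'_poly [c [P [gP eP]]]]|_] := boolP (x \in s); last by exists 0.
  by exists P => _; split=> //; exists c.
have [|D [c [gD dD ND]]] := graded_gcd_seq fracS_subgrp fracS1 fracSM fracSV
    (g := g) (s := map phi s).
  move=> _ /mapP [x /phiP [[c gP] _] ->]; exists c => i; exact: modhom_fracS.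
have [psi psiP] : {psi : K -> {poly K} & forall x, x \in s ->
    (exists c, gpoly fracS g c (psi x)) /\ phi x = psi x * D}.
  apply: (choice (P := fun x P => x \in s ->
    (exists c, gpoly fracS g c P) /\ phi x = P * D)) => x.
  have [xs|_] := boolP (x \in s); last by exists 0.
  have [c1 [P [gP eP]]] := dD (phi x) (map_f _ xs).
  by exists P => _; split=> //; exists c1.
have xE x : x \in s -> x = (psi x).[1] * D.[1].
  by move=> xs; rewrite -hornerM -(psiP x xs).2 (phiP x xs).2.
have D1n0 : D.[1] != 0.
  by apply: contra_neq x0n0 => D0; rewrite (xE _ sx0) D0 mulr0.
have [|e [h [Mh hn0 Hh]]] := common_denominator_poly (l := map psi s).
  by move=> _ /mapP [x /psiP [gP _] ->].
pose F x := h *: psi x.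
have gF x : x \in s -> exists c, gpoly (modhom S N) g c (F x).
  by move=> xs; apply: Hh; apply: map_f.
pose cs := flatten [seq (F x : seq K) | x <- s].
have csP x i : x \in s -> (F x)`_i \in cs \/ (F x)`_i = 0.
  move=> xs; have [iF|Fi] := ltnP i (size (F x)); last by right; rewrite nth_default.
  by left; apply/flatten_mapP; exists x => //; apply: mem_nth.
have [u [uT uU]] : tinv T cs.
  apply: tinvS.
    move=> _ /flatten_mapP [x /gF [c1 gFx] /(nthP 0) [i _ <-]].
    by exists N, (g *+ i + c1).
  exists (lead_coef (F x0)).
    apply/flatten_mapP; exists x0; rewrite // lead_coefE mem_nth // ltn_predL size_poly_gt0.
    rewrite scaler_eq0 (negbTE hn0) /=; apply: contra_neq x0n0 => p0.
    by rewrite (xE _ sx0) p0 horner0 mul0r.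
  rewrite lead_coef_eq0 scaler_eq0 (negbTE hn0) /=; apply: contra_neq x0n0 => p0.
  by rewrite (xE _ sx0) p0 horner0 mul0r.
have aE a b : a \in s -> a * (h / D.[1] * b) = (F a).[1] * b.
  by move=> sa; rewrite {1}(xE _ sa) /F hornerZ; field.
exists [seq h / D.[1] * b | b <- u]; split.
  move=> a _ sa /mapP [b bu ->]; rewrite aE // horner_coef mulr_suml.
  apply: (subgrp_sum gT) => i _; rewrite expr1n mulr1.
  have [/uT|->] := csP a i sa; first exact.
  by rewrite mul0r; apply: subgrp0.
move=> x Hx.
have {}Hx a b : a \in s -> b \in u -> T (x * b * (F a).[1]).
  move=> sa bu; rewrite -mulrA [b * _]mulrC -aE //; apply: Hx => //; exact: map_f.
(* The polynomials P with [x * b * P.[1] / D.[1]] in [locS] form a graded ideal that contains every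
   [phi a], hence contains D. *)
have locx b : b \in u -> locS (x * b).
  move=> bu; suff : locS (x * b * D.[1] / D.[1]) by rewrite mulfK.
  apply: (ND (fun P => locS (x * b * P.[1] / D.[1]))) => [|/=|P].
  - split=> [P P' LP LP'|c1 U P gU LP] /=.
      by rewrite hornerD mulrDr mulrDl; apply: locSD.
    have -> : x * b * (U * P).[1] / D.[1] = U.[1] * (x * b * P.[1] / D.[1]).
      by rewrite hornerM; ring.
    by apply: locSM => //; apply: locS_eval gU.
  - by rewrite horner0 mulr0 mul0r; apply: T_locS; apply: subgrp0.
  - move=> /mapP [a sa ->]; rewrite (phiP a sa).2 {1}(xE _ sa).
    exists e, (x * b * (F a).[1]), h; split=> //; first exact: Hx.
    by rewrite /F hornerZ; field; rewrite hn0.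
apply: uU => z b /flatten_mapP [a sa /(nthP 0) [i _ <-]] bu.
have [e1 [y [k [Ty Mk kn0 exb]]]] := locx b bu.
have [c1 gFa] := gF a sa.
rewrite mulrCA mulrC exb; apply: (gauss gFa N0 Mk kn0 Ty).
by rewrite -exb; apply: Hx.
Qed.

End FixedMultiplier.

Lemma hom_tinv_indep : hom_tinv S'.
Proof.
move=> s Ms sn0.
(* Each entry comes with its own multiplier; their product serves for all, since N and e may be
   multiplied by the same integer. *)
suff [N [N0 HN]] : exists N, (0 < N)%N /\ forall x, x \in s -> exists e, modhom S' N e x.
  exact: (tinv_fixed_multiplier N0 HN).
have scale N k e x : modhom S' N e x -> modhom S' (N * k) (e *+ k) x.
  apply: hsum_mono => a /= Sa; rewrite mulrnA -mulrnBl.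
  exact: (subgrpMn subgrpS').
elim: s Ms {sn0} => [|x s IH] Ms; first by exists 1%N.
have [|N [N0 HN]] := IH; first by move=> y ys; apply: Ms; rewrite inE ys orbT.
have [M [e [M0 Mx]]] := Ms x (mem_head _ _).
exists (M * N)%N; split; first by rewrite muln_gt0 M0.
move=> y; rewrite inE => /orP [/eqP ->|/HN [e' My]]; first by exists (e *+ N); apply: scale.
by exists (e' *+ M); rewrite mulnC; apply: scale.
Qed.
End OneStep.

(** If (n+1) g lies in [S], an element homogeneous modulo the enlarged subgroup is homogeneous
    modulo [S] once its multiplier is multiplied by n+1. Otherwise the one-variable argument
    applies. *)
Lemma hom_tinv_adjoin S g : subgrp S -> hom_tinv S -> hom_tinv (adjoin S g).
Proof.
move=> gS tS; have [[n Sn]|indep] := pselect (exists n, S (g *+ n.+1)); last first.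
  by apply: hom_tinv_indep => // n Sn; apply: indep; exists n.
move=> s Ms; apply: tS => x /Ms [N [e [N0 Mx]]].
exists (N * n.+1)%N, (e *+ n.+1); split; first by rewrite muln_gt0 N0.
apply: hsum_mono Mx => a [m Sa] /=.
have -> : a *+ (N * n.+1) - e *+ n.+1 = (a *+ N - e - g *~ m) *+ n.+1 + (g *+ n.+1) *~ m.
  have -> : (g *+ n.+1) *~ m = (g *~ m) *+ n.+1 by rewrite !pmulrn -!mulrzA mulrC.
  by rewrite -mulrnDl subrK mulrnBl mulrnA.
apply: (subgrpD gS); first exact: subgrpMn.
case: m {Sa} => k; first exact: subgrpMn.
by rewrite NegzE mulrNz; apply: (subgrpN gS); apply: (subgrpMn gS).
Qed.

(** Only finitely many degrees occur in [s]; they are adjoined one at a time to the zero subgroup.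
    Modulo the final subgroup every entry is homogeneous, with multiplier 1 and degree 0. *)
Lemma tinv_of_homogeneous :
  (forall n (a : G), a *+ n.+1 = 0 -> a = 0) ->
  (forall s : seq K, (forall x, x \in s -> exists a, T x /\ A a x) ->
    (exists2 x, x \in s & x != 0) -> tinv T s) ->
  forall s : seq K, (forall x, x \in s -> T x) ->
    (exists2 x, x \in s & x != 0) -> tinv T s.
Proof.
move=> tf tinv0 s Ts.
have [d Hd] : exists d : seq G, forall x, x \in s -> hsum E [set a | a \in d] x.
  elim: s Ts => [|x s IH] Ts; first by exists [::].
  have [|d Hd] := IH; first by move=> y ys; apply: Ts; rewrite inE ys orbT.
  have [l [Hl ex]] := TE (Ts x (mem_head _ _)).
  exists (map fst l ++ d) => y; rewrite inE => /orP [/eqP ->|/Hd]; last first.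
    by apply: hsum_mono => a /= ad; rewrite mem_cat ad orbT.
  exists l; split=> // p pl; split; last by have [] := Hl p pl.
  by rewrite /= mem_cat map_f.
pose S := foldr (fun g S => adjoin S g) [set 0] d.
have [gS tS] : subgrp S /\ hom_tinv S.
  rewrite /S; elim: d {Hd S} => [|g d [gS tS]] /=; last first.
    by split; [apply: adjoin_subgrp | apply: hom_tinv_adjoin].
  split; first by split=> //= x y -> ->; rewrite subr0.
  move=> s' Ms'; apply: tinv0 => x /Ms' [N [e [N0 [l [Hl ->]]]]].
  case: N N0 Hl => // N _ Hl.
  (* Over the zero subgroup all degrees a in the list satisfy (N+1) a = e, and torsion-freeness
     makes them equal: the element is homogeneous. *)
  have eqdeg p q : p \in l -> q \in l -> p.1 = q.1.
    move=> /Hl [/= /eqP + _] /Hl [/= /eqP + _]; rewrite !subr_eq0 => /eqP ep /eqP eq.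
    apply/eqP; rewrite -subr_eq0; apply/eqP; apply: (tf N).
    by rewrite mulrnBl ep eq subrr.
  case: l Hl eqdeg => [|p l] Hl eqdeg.
    by exists 0; rewrite big_nil; have [] := subgrp0 (gE 0).
  exists p.1; apply: (subgrp_sum_seq (gE p.1)) => q ql.
  by rewrite (eqdeg p q (mem_head _ _) ql); have [] := Hl q ql.
apply: tS => x /Hd Mx; exists 1%N, 0; split=> //.
apply: hsum_mono Mx => a /=; rewrite mulr1n subr0 /S.
elim: d {S gS Hd} => [//|g d IH] /=; rewrite inE => /orP [/eqP ->|/IH]; last exact: sub_adjoin.
have g0 : subgrp (foldr (fun g S => adjoin S g) [set 0] d).
  elim: d {IH} => [|g' d] /=; last exact: adjoin_subgrp.
  by split=> //= x' y -> ->; rewrite subr0.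
by exists 1; rewrite mulr1z subrr; apply: subgrp0.
Qed.

End HomogeneousInvertibility.

(** * Generated submodules and integral closedness *)

Section GeneratedSubmodules.
Local Open Scope ring_scope.
Variable K : fieldType.
Implicit Types (D E F I T : set K) (s : seq K).

Lemma is_submod_subgrp D E : is_subring D -> is_submod D E -> subgrp E.
Proof.
move=> [D0 D1 DB _] [E0 ED EM]; split=> // x y Ex Ey.
apply: ED => //; rewrite -mulN1r; apply: EM => //.
by rewrite -sub0r; apply: DB.
Qed.

Lemma gen_sub D E s : is_submod D E -> (forall x, x \in s -> E x) -> gen D s `<=` E.
Proof.
move=> [E0 ED EM] Es _ [r [Dr ->]]; apply: (big_ind E) => // i _.
by apply: EM => //; apply: Es; apply: mem_nth.
Qed.

Lemma gen_mem D s x : is_subring D -> x \in s -> gen D s x.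
Proof.
move=> rD xs; exists (fun i => if i == index x s then 1 else 0); split.
  by move=> i; case: ifP => _; [exact: is_subring1 | case: rD].
have ix : (index x s < size s)%N by rewrite index_mem.
rewrite (bigD1 (Ordinal ix)) //= eqxx mul1r nth_index // big1 ?addr0 // => i ne.
by rewrite ifN ?mul0r.
Qed.

Lemma gen_submod D s : is_subring D -> is_submod D (gen D s).
Proof.
move=> rD; have gD := is_subring_subgrp rD; split.
- exists (fun=> 0); split=> [_|]; first exact: subgrp0.
  by rewrite big1 // => i _; rewrite mul0r.
- move=> _ _ [r [Dr ->]] [q [Dq ->]]; exists (fun i => r i + q i); split.
    by move=> i; apply: (subgrpD gD).
  by rewrite -big_split; apply: eq_bigr => i _; rewrite mulrDl.
- move=> a _ Da [r [Dr ->]]; exists (fun i => a * r i); split.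
    by move=> i; apply: is_subringM.
  by rewrite mulr_sumr; apply: eq_bigr => i _; rewrite mulrA.
Qed.

Lemma gen_subset D s s' : is_subring D -> (forall x, x \in s -> x \in s') ->
  gen D s `<=` gen D s'.
Proof.
move=> rD ss; apply: gen_sub; first exact: gen_submod.
by move=> x /ss; apply: gen_mem.
Qed.

Lemma gen_nonzero D s : nonzero (gen D s) -> exists2 x, x \in s & x != 0.
Proof.
move=> [y [yn0 [r [_ ey]]]]; have [/hasP|/hasPn s0] := boolP (has (predC1 0) s); first by [].
move: yn0; rewrite ey big1 ?eqxx // => i _.
by have /negPn/eqP -> := s0 _ (mem_nth 0 (ltn_ord i)); rewrite mulr0.
Qed.

Lemma scale_submod D E (x : K) : is_submod D E -> is_submod D [set y | E (x * y)].
Proof.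
move=> [E0 ED EM]; split=> /= [|y z Ey Ez|r y Dr Ey]; first by rewrite mulr0.
  by rewrite mulrDr; apply: ED.
by rewrite mulrCA; apply: EM.
Qed.

Lemma is_submod_refl D T : is_subring D -> is_subring T -> D `<=` T -> is_submod D T.
Proof.
move=> rD rT DT; have gT := is_subring_subgrp rT; split; first exact: subgrp0.
  by move=> *; apply: subgrpD.
by move=> r x Dr Tx; apply: is_subringM => //; apply: DT.
Qed.

Lemma colon_genP D s x : is_subring D ->
  (forall a, a \in s -> D (x * a)) -> colon D (gen D s) x.
Proof.
move=> rD Ds; apply: gen_sub => //.
by apply: (scale_submod x); apply: is_submod_refl.
Qed.

Lemma prodm_mem E F x y : E x -> F y -> prodm E F (x * y).
Proof.
move=> Ex Fy; exists [:: (x, y)]; split; last by rewrite big_seq1.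
by move=> p; rewrite inE => /eqP ->.
Qed.

Lemma prodm_sub E F (W : set K) : subgrp W -> (forall x y, E x -> F y -> W (x * y)) ->
  prodm E F `<=` W.
Proof.
by move=> gW EFW _ [s [Hs ->]]; apply: subgrp_sum_seq => // p /Hs []; apply: EFW.
Qed.

Lemma prodm_submod D E F : is_submod D E -> is_submod D (prodm E F).
Proof.
move=> [E0 ED EM]; split.
- by exists [::]; rewrite big_nil.
- move=> _ _ [s [Hs ->]] [t [Ht ->]]; exists (s ++ t); rewrite big_cat; split=> // p.
  by rewrite mem_cat => /orP [/Hs|/Ht].
- move=> r _ Dr [s [Hs ->]]; exists [seq (r * p.1, p.2) | p <- s]; split.
    by move=> _ /mapP [p /Hs [Ep Fp] ->] /=; split=> //; apply: EM.
  by rewrite big_map mulr_sumr; apply: eq_bigr => p _; rewrite mulrA.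
Qed.

Lemma prodm_colon_sub D E : is_subring D -> prodm E (colon D E) `<=` D.
Proof.
move=> rD; apply: prodm_sub; first exact: is_subring_subgrp.
by move=> x y Ex cy; rewrite mulrC; apply: cy.
Qed.

Lemma t_op1 T : is_subring T -> t_op T T 1.
Proof.
move=> rT; exists (gen T [:: 1]); split.
- by exists [:: 1].
- by exists 1; rewrite oner_neq0; split=> //; apply: gen_mem; rewrite ?inE.
- apply: gen_sub; first exact: is_submod_refl.
  by move=> x; rewrite inE => /eqP ->; apply: is_subring1.
- by move=> z; rewrite mul1r => cz; rewrite -[z]mulr1; apply: cz; apply: gen_mem; rewrite ?inE.
Qed.

Lemma t_op_sub T E x : is_subring T -> E `<=` T -> t_op T E x -> T x.
Proof.
move=> rT ET [F [_ _ FE vF]]; rewrite -[x]mulr1; apply: vF => y Fy.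
by rewrite mul1r; apply: ET; apply: FE.
Qed.

(** An element of (T : E) lies in (T : F) for the finitely generated F inside E, and 1 in the
    v-closure of F says that (T : F) lies in [T]. *)
Lemma t_op1_colon T E x : t_op T E 1 -> (forall y, E y -> T (x * y)) -> T x.
Proof.
move=> [F [_ _ FE vF]] Ex; rewrite -[x]mul1r; apply: vF => y Fy.
by apply: Ex; apply: FE.
Qed.

Lemma PvMD_of_tinv T : is_subring T ->
  (forall s, (forall x, x \in s -> T x) -> (exists2 x, x \in s & x != 0) -> tinv T s) ->
  PvMD T.
Proof.
move=> rT tT I sI IT [s eI] nI.
have Is x : x \in s -> I x by rewrite eI; apply: gen_mem.
have sn0 : exists2 x, x \in s & x != 0 by apply: (@gen_nonzero T); rewrite -eI.
have [a0 sa0 a0n0] := sn0.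
have [u [uT uU un0]] : exists u : seq K, [/\ forall a b, a \in s -> b \in u -> T (a * b),
    forall x, (forall a b, a \in s -> b \in u -> T (x * (a * b))) -> T x &
    exists2 b, b \in u & b != 0].
  have [u [uT uU]] := tT s (fun x xs => IT _ (Is _ xs)) sn0.
  have [/hasP|/hasPn u0] := boolP (has (predC1 0) u); first by exists u.
  (* If all entries of [u] vanish, the second clause of [tinv] forces T = K, and then any nonzero
     list serves. A nonzero entry is wanted because [star_f] ranges over nonzero submodules. *)
  have allT x : T x.
    apply: uU => a b _ /u0 /negPn /eqP ->; rewrite !mulr0; by case: rT.
  by exists [:: a0]; split=> //; exists a0; rewrite ?inE.
have [b0 ub0 b0n0] := un0.
pose ab := [seq a * b | a <- s, b <- u].
apply/seteqP; split=> y.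
  move=> [F [fF nF FI vF]]; exists F; split=> //.
  by apply: subset_trans FI _; apply: prodm_colon_sub.
move/(t_op_sub rT (fun z Tz => Tz)) => Ty; exists (gen T ab); split.
- by exists ab.
- exists (a0 * b0); split; first by rewrite mulf_neq0.
  by apply: gen_mem => //; apply/allpairsP; exists (a0, b0).
- apply: gen_sub; first exact: prodm_submod.
  move=> _ /allpairsP [[a b] /= [sa ub ->]]; apply: prodm_mem; first exact: Is.
  by rewrite eI; apply: colon_genP => // c sc; rewrite mulrC; apply: uT.
- move=> z cz; apply: is_subringM => //; apply: uU => a b sa ub.
  by apply: cz; apply: gen_mem => //; apply/allpairsP; exists (a, b).
Qed.

(* If [x] is integral over [T], the finitely generated module [T[x]], scaled into [T], is stable
   under [x], hence so is its [t]-closed product with its inverse. *)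
Lemma int_closed_of_PvMD T : is_subring T ->
  (forall x, exists a b, [/\ T a, T b, b != 0 & x = a / b]) -> PvMD T -> int_closed T.
Proof.
move=> rT fracT PT p x pm Tp px; have gT := is_subring_subgrp rT.
have [a [b [Ta Tb bn0 ex]]] := fracT x.
(* The degree of p is n+1, so 1, x, ..., x^n generate T[x]; the factor b^n in [M] moves these powers
   into [T]. *)
pose n := (size p).-2; have sp : size p = n.+2.
  have := root_size_gt1 (monic_neq0 pm) px; rewrite /n; by case: (size p) => [|[]].
pose M i := b ^+ n * x ^+ i.
have TM i : (i <= n)%N -> T (M i).
  move=> ni; have -> : M i = a ^+ i * b ^+ (n - i).
    by rewrite /M ex -{1}(subnK ni) exprD expr_div_n; field; rewrite expf_neq0.
  by apply: is_subringM => //; apply: is_subringX.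
pose s := [seq M i | i <- iota 0 n.+1]; pose I := gen T s.
have sI : is_submod T I by apply: gen_submod.
have IM i : (i <= n)%N -> I (M i).
  by move=> ni; apply: gen_mem => //; apply: map_f; rewrite mem_iota.
have IT : I `<=` T.
  apply: gen_sub; first exact: is_submod_refl.
  by move=> _ /mapP [i + ->]; rewrite mem_iota => ?; apply: TM.
have xI y : I y -> I (x * y).
  move: y; apply: (gen_sub (scale_submod x sI)).
  move=> _ /mapP [i + ->]; rewrite mem_iota /= add0n ltnS leq_eqVlt => /orP [/eqP ->|ni].
    have -> : x * M n = - \sum_(j < n.+1) p`_j * M j.
      move/rootP: px; rewrite horner_coef sp big_ord_recr /=.
      have -> : p`_n.+1 = 1 by move/monicP: pm; rewrite lead_coefE sp.
      rewrite mul1r => /eqP; rewrite addrC addr_eq0 => /eqP e.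
      rewrite /M mulrCA -exprS e mulrN mulr_sumr; congr (- _).
      by apply: eq_bigr => j _; rewrite mulrCA.
    apply: (subgrpN (is_submod_subgrp rT sI)).
    apply: (subgrp_sum (is_submod_subgrp rT sI)) => j _.
    by case: sI => _ _ IZ; apply: IZ => //; apply: IM; rewrite -ltnS.
  by rewrite /M mulrCA -exprS; apply: IM.
have nI : nonzero I.
  exists (M 0%N); split; last exact: IM.
  by rewrite /M expr0 mulr1 expf_neq0.
have eT := PT I sI IT (ex_intro _ s erefl) nI.
apply: (t_op1_colon (E := prodm I (colon T I))); first by rewrite eT; apply: t_op1.
have gx : subgrp [set y | T (x * y)] by apply: subgrp_scale.
apply: (prodm_sub gx) => y z Iy cz /=.
by rewrite mulrA mulrC; apply: cz; apply: xI.
Qed.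

End GeneratedSubmodules.

(** * Homogeneous ideals and overrings *)

Section HomogeneousIdeals.
Local Open Scope ring_scope.
Variables (K : fieldType) (G : zmodType).
Implicit Types (E : G -> set K) (D I : set K).

Lemma homog_ideal_hsum D E I x : homog_ideal D E I -> I x ->
  hsum (fun a => E a `&` I) setT x.
Proof. by move=> [_ _ dI] /dI; apply: decomposes_hsum. Qed.

(** The components of a generator lie in the ideal, so they can replace it. *)
Lemma homog_generators D E I : is_subring D -> homog_ideal D E I -> fin_gen D I ->
  exists s, (forall x, x \in s -> exists a, E a x) /\ I = gen D s.
Proof.
move=> rD hI [s0 eI]; have [sI _ _] := hI.
have Is0 x : x \in s0 -> I x by rewrite eI; apply: gen_mem.
suff [s [Es Is gs]] : exists s : seq K, [/\ forall x, x \in s -> exists a, E a x,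
    forall x, x \in s -> I x & forall x, x \in s0 -> gen D s x].
  exists s; split=> //; apply/seteqP; split; last exact: gen_sub.
  by rewrite eI; apply: gen_sub => //; apply: gen_submod.
elim: s0 Is0 {eI} => [|y s0 IH] Is0; first by exists [::].
have [|s [Es Is gs]] := IH; first by move=> x xs; apply: Is0; rewrite inE xs orbT.
have [l [Hl ey]] := homog_ideal_hsum hI (Is0 y (mem_head _ _)).
exists (map snd l ++ s); split=> x.
- by rewrite mem_cat => /orP [/mapP [p /Hl [_ [Ep _]] ->]|/Es //]; exists p.1.
- by rewrite mem_cat => /orP [/mapP [p /Hl [_ [_ Ip]] ->]|/Is].
rewrite inE => /orP [/eqP ->|/gs]; last first.
  by apply: gen_subset => // z zs; rewrite mem_cat zs orbT.
have gg := is_submod_subgrp rD (gen_submod (map snd l ++ s) rD).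
rewrite ey; apply: (subgrp_sum_seq gg) => p pl; apply: gen_mem => //.
by rewrite mem_cat map_f.
Qed.

Lemma gen_homog_ideal D E s : is_subring D ->
  (forall a, subgrp (E a)) -> (forall a b x y, E a x -> E b y -> E (a + b) (x * y)) ->
  (forall a, E a `<=` D) -> (forall x, D x -> hsum E setT x) ->
  (forall x, x \in s -> exists a, E a x) -> homog_ideal D E (gen D s).
Proof.
move=> rD gE EM ED DE Es; have sg := gen_submod s rD.
have gg := is_submod_subgrp rD sg.
split=> //.
  apply: gen_sub; first exact: is_submod_refl.
  by move=> x /Es [a /ED].
have gI a : subgrp (E a `&` gen D s).
  split=> [|x y [Ex gx] [Ey gy]]; first by split; [apply: (subgrp0 (gE a)) | apply: subgrp0].
  by split; [apply: (subgrpB (gE a)) | apply: (subgrpB gg)].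
move=> x gx; apply: (hsum_decomposes (P := setT) gI).
move: x gx; apply: gen_sub => [|x xs]; last first.
  by have [a Ex] := Es x xs; apply: (hsum_homog (a := a)) => //; split=> //; apply: gen_mem.
split; first exact: hsum0.
  by move=> *; apply: hsumD.
move=> r x /DE Hr Hx; apply: (hsumM (P3 := setT) _ _ Hr Hx) => // a b u v Eu [Ev gv].
by split; [apply: EM | case: sg => _ _; apply=> //; apply: ED Eu].
Qed.

End HomogeneousIdeals.

(** * The grading of the homogeneous quotient field *)

Section GradedDomain.
Local Open Scope ring_scope.
Variables (K : fieldType) (G : zmodType) (Gam : set G) (R : set K) (C : G -> set K).
Hypothesis gdR : graded_domain Gam R C.

Lemma graded_subringR : is_subring R. Proof. by case: gdR. Qed.
Let rR := graded_subringR.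
Let gR : subgrp R. Proof. exact: is_subring_subgrp. Qed.

Lemma comp_subgrp a : subgrp (C a).
Proof. by case: gdR => _ _ _ [/(_ a) [_ [C0 CB]] _ _ _]. Qed.
Let gC := comp_subgrp.

Lemma comp_sub a : C a `<=` R.
Proof. by case: gdR => _ _ _ [/(_ a) []]. Qed.

Lemma compM a b x y : C a x -> C b y -> C (a + b) (x * y).
Proof. by case: gdR => _ _ _ [_ _ CM _]; apply: CM. Qed.

Lemma comp_direct : direct C.
Proof. by case: gdR => _ _ _ [_ _ _ []]. Qed.

Lemma comp_decomposes x : R x -> hsum C setT x.
Proof. by case: gdR => _ _ _ [_ _ _ [dR _]] /dR; apply: decomposes_hsum. Qed.

Lemma hsum1_comp (E : G -> set K) b x : (forall a, subgrp (E a)) ->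
  hsum E [set b] x -> E b x.
Proof. by move=> gE; apply: (hsum_subset (gE b)) => a ->. Qed.

(** Let e be the degree 0 part of 1 and f_b a nonzero component of 1. Comparing the parts of degree
    b in f_b = f_b 1 gives f_b = f_b e, hence e = 1. *)
Lemma comp1 : C 0 1.
Proof.
have [s [f [us Cf e1]]] : decomposes C 1.
  by case: gdR => _ _ _ [_ _ _ [dR _]]; apply: dR; apply: is_subring1.
have [b sb fn0] : exists2 b, b \in s & f b != 0.
  have [/hasP|/hasPn f0] := boolP (has (fun a => f a != 0) s); first by [].
  have := oner_neq0 K; rewrite e1 big_seq big1 ?eqxx // => a /f0.
  by move/negPn/eqP.
have [e [r [He Hr er]]] := hsum_split [set 0] (comp_decomposes (is_subring1 rR)).
have Ce : C 0 e.
  by apply: (hsum1_comp gC); apply: hsum_mono He => a [].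
suff : f b = f b * e by move/(congr1 (fun x => (f b)^-1 * x)); rewrite mulVf // mulKf // => ->.
apply: (hsum_compare (P := [set b]) (x' := 0) (y' := f b * r) gC comp_direct).
- by apply: (hsum_homog (a := b)) => //; apply: Cf.
- apply: (hsum_homog (a := b)) => //; have := compM (Cf _ sb) Ce; by rewrite addr0.
- exact: hsum0.
- have Hb : hsum C [set b] (f b) by apply: (hsum_homog (a := b)) => //; apply: Cf.
  apply: (hsumM compM _ Hb Hr) => a c /= -> [_ c0] bc; apply: c0.
  by apply: (addrI b); rewrite bc addr0.
- by rewrite -mulrDr -er mulr1 addr0.
Qed.

Lemma comp_RH_comp a : C a `<=` RH_comp C a.
Proof.
move=> x Cx; exists a, 0, x, 1; split=> //; rewrite ?oner_neq0 ?subr0 ?divr1 //.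
exact: comp1.
Qed.

Lemma RH_comp_subgrp a : subgrp (RH_comp C a).
Proof.
split; first by apply: comp_RH_comp; apply: subgrp0.
move=> _ _ [b [g [p [h [Cp Ch hn0 <- ->]]]]] [b' [g' [p' [h' [Cp' Ch' h'n0 e ->]]]]].
exists (b + g'), (g + g'), (p * h' - p' * h), (h * h'); split.
- apply: (subgrpB (gC _)); first exact: compM.
  have -> : b + g' = b' + g.
    by apply/eqP; rewrite -subr_eq -addrA [g' - g]addrC addrA -e subrK.
  exact: compM.
- exact: compM.
- by rewrite mulf_neq0.
- by rewrite opprD addrACA subrr addr0.
- by field; rewrite hn0 h'n0.
Qed.

Lemma RH_compM a b x y : RH_comp C a x -> RH_comp C b y -> RH_comp C (a + b) (x * y).
Proof.
move=> [c [g [p [h [Cp Ch hn0 <- ->]]]]] [c' [g' [p' [h' [Cp' Ch' h'n0 <- ->]]]]].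
exists (c + c'), (g + g'), (p * p'), (h * h'); split; try exact: compM.
- by rewrite mulf_neq0.
- by rewrite opprD addrACA.
- by field; rewrite hn0 h'n0.
Qed.

Lemma RH_compV a x : RH_comp C a x -> RH_comp C (- a) x^-1.
Proof.
move=> [b [g [p [h [Cp Ch hn0 <- ->]]]]].
have [->|pn0] := eqVneq p 0.
  by rewrite mul0r invr0; apply: (subgrp0 (RH_comp_subgrp _)).
by exists g, b, h, p; split=> //; rewrite ?opprB ?invf_div.
Qed.


Lemma RH_compX a x n : RH_comp C a x -> RH_comp C (a *+ n) (x ^+ n).
Proof.
move=> Ax; elim: n => [|n IH]; first by apply: comp_RH_comp; apply: comp1.
by rewrite mulrS exprS; apply: RH_compM.
Qed.

Lemma RH_comp_common_denominator (I : eqType) (s : seq I) (d : I -> G) (f : I -> K) :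
  (forall i, i \in s -> RH_comp C (d i) (f i)) ->
  exists h g, [/\ C g h, h != 0 & forall i, i \in s -> C (g + d i) (h * f i)].
Proof.
elim: s => [|a s IH] Hf.
  by exists 1, 0; split; rewrite ?oner_neq0 //; apply: comp1.
have [|h [g [Ch hn0 Hh]]] := IH; first by move=> b bs; apply: Hf; rewrite inE bs orbT.
have [b [g' [p [k [Cp Ck kn0 ea ep]]]]] := Hf a (mem_head _ _).
exists (h * k), (g + g'); split; [exact: compM | by rewrite mulf_neq0 |].
move=> c; rewrite inE => /orP [/eqP ->|/Hh Cc].
  have -> : h * k * f a = h * p by rewrite ep; field.
  have -> : g + g' + d a = g + b by rewrite -addrA -ea [g' + _]addrC subrK.
  exact: compM.
by rewrite addrAC mulrAC; apply: compM.
Qed.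

(** A common homogeneous denominator shifts all degrees by the same amount and reduces the claim to
    [C]. *)
Lemma RH_comp_direct : direct (RH_comp C).
Proof.
move=> s f us Af s0 a sa.
have [h [g [Ch hn0 Hh]]] := RH_comp_common_denominator (d := id) Af.
suff : h * f a = 0 by move/eqP; rewrite mulf_eq0 (negbTE hn0) => /eqP.
have := @comp_direct (map (+%R g) s) (fun b => h * f (b - g)).
have eqg c : g + c - g = c by rewrite addrC addKr.
rewrite map_inj_uniq; last exact: addrI.
move=> /(_ us) H; rewrite -(eqg a); apply: H (map_f _ sa).
  by move=> _ /mapP [c sc ->]; rewrite eqg; apply: Hh.
transitivity (h * \sum_(c <- s) f c); last by rewrite s0 mulr0.
rewrite big_map mulr_sumr; apply: eq_bigr => c _; by rewrite eqg.
Qed.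

Lemma comp_hsum_RH P x : hsum C P x -> hsum (RH_comp C) P x.
Proof. by move=> [l [Hl ->]]; exists l; split=> // p /Hl [Pp /comp_RH_comp]. Qed.

Lemma RH_comp_R a x : RH_comp C a x -> R x -> C a x.
Proof.
move=> Ax Rx.
have [x1 [x2 [H1 H2 ex]]] := hsum_split [set a] (comp_decomposes Rx).
have {}H1 : hsum C [set a] x1 by apply: hsum_mono H1 => b [].
have {}H2 : hsum C [set b | b <> a] x2 by apply: hsum_mono H2 => b [].
suff -> : x = x1 by apply: (hsum1_comp gC).
apply: (hsum_compare (P := [set a]) (x' := 0) (y' := x2) RH_comp_subgrp RH_comp_direct).
- exact: (hsum_homog (a := a)).
- exact: comp_hsum_RH.
- exact: hsum0.
- exact: comp_hsum_RH.
- by rewrite addr0.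
Qed.

Lemma homog_overring_setting T : homog_overring R C T -> graded_subring (RH_comp C) T.
Proof.
move=> [rT _ _ dT]; split=> //.
- split; [exact: RH_comp_subgrp | apply: comp_RH_comp; exact: comp1].
- exact: RH_compM.
- exact: RH_comp_direct.
- by move=> x /dT; apply: decomposes_hsum.
Qed.

Lemma over_comp_subgrp T a : is_subring T -> subgrp (over_comp C T a).
Proof.
move=> /is_subring_subgrp gT; have gA := RH_comp_subgrp a.
split=> [|x y [Tx Ax] [Ty Ay]]; first by split; apply: subgrp0.
by split; apply: subgrpB.
Qed.

Lemma over_compM T a b x y : is_subring T ->
  over_comp C T a x -> over_comp C T b y -> over_comp C T (a + b) (x * y).
Proof.
by move=> rT [Tx Ax] [Ty Ay]; split; [apply: is_subringM | apply: RH_compM].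
Qed.

Lemma gen_homog_ideal_overring T s : homog_overring R C T ->
  (forall x, x \in s -> exists a, over_comp C T a x) ->
  homog_ideal T (over_comp C T) (gen T s).
Proof.
move=> [rT _ _ dT]; apply: gen_homog_ideal => //.
- by move=> a; apply: over_comp_subgrp.
- by move=> *; apply: over_compM.
- by move=> a x [].
- by move=> x /dT; apply: decomposes_hsum.
Qed.

Lemma gen_homog_idealR s : (forall x, x \in s -> exists a, C a x) ->
  homog_ideal R C (gen R s).
Proof.
apply: gen_homog_ideal => //; [exact: compM | exact: comp_sub | exact: comp_decomposes].
Qed.

Lemma torsion_free n (a : G) : a *+ n.+1 = 0 -> a = 0.
Proof. by case: gdR => [[_ _ _ tf] _ _ _]; apply: tf. Qed.

Lemma homog_overring_frac T : homog_overring R C T ->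
  forall x, exists a b, [/\ T a, T b, b != 0 & x = a / b].
Proof.
move=> [_ RT _ _] x; case: gdR => _ _ /(_ x) [a [b [Ra Rb bn0 ->]]] _.
by exists a, b; split=> //; apply: RT.
Qed.

Lemma PvMD_of_homogeneous T : homog_overring R C T ->
  (forall s : seq K, (forall x, x \in s -> exists a, T x /\ RH_comp C a x) ->
    (exists2 x, x \in s & x != 0) -> tinv T s) -> PvMD T.
Proof.
move=> oT hT; have [rT _ _ _] := oT; apply: PvMD_of_tinv => //.
exact: (tinv_of_homogeneous (homog_overring_setting oT) torsion_free hT).
Qed.

(** Writing 1 as a sum of products from I and (T : I) provides [u], the list of second factors: if x
    multiplies I u into [T], then x = x 1 lies in [T]. *)
Lemma graded_Prufer_PvMD T : homog_overring R C T -> graded_Prufer C T -> PvMD T.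
Proof.
move=> oT PT; have [rT _ _ _] := oT; apply: PvMD_of_homogeneous => // s Hs [x0 sx0 x0n0].
have Ts x : x \in s -> T x by move=> /Hs [a []].
have : prodm (gen T s) (colon T (gen T s)) 1.
  rewrite PT; first exact: is_subring1.
  split; first exact: gen_homog_ideal_overring.
    by exists s.
  by exists x0; split=> //; apply: gen_mem.
move=> [l [Hl e1]]; exists (map snd l); split.
  move=> a _ sa /mapP [p /Hl [_ cp] ->]; rewrite mulrC; apply: cp; exact: gen_mem.
move=> x Hx; rewrite -[x]mulr1 e1 mulr_sumr.
apply: (subgrp_sum_seq (is_subring_subgrp rT)) => p pl; have [gp _] := Hl p pl.
have gx : is_submod T [set y | T (x * p.2 * y)].
  by apply: scale_submod; apply: is_submod_refl.
have -> : x * (p.1 * p.2) = x * p.2 * p.1 by ring.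
apply: (gen_sub gx) gp => a sa /=; rewrite -mulrA [p.2 * _]mulrC; apply: Hx => //.
exact: map_f.
Qed.

End GradedDomain.

(** * Semistar invertibility *)

Section Semistar.
Local Open Scope ring_scope.
Variables (K : fieldType) (G : zmodType) (Gam : set G) (R : set K) (C : G -> set K).
Variable st : set K -> set K.
Hypothesis gdR : graded_domain Gam R C.
Hypothesis sst : is_semistar R st.

Let rR : is_subring R. Proof. exact: graded_subringR gdR. Qed.
Let gR : subgrp R. Proof. exact: is_subring_subgrp. Qed.

Let nzR : nz_submod R R.
Proof.
split; first exact: is_submod_refl.
by exists 1; rewrite oner_neq0; split=> //; apply: is_subring1.
Qed.

Lemma st1 : st R 1.
Proof. by have [_ _ _ H _] := sst nzR nzR; apply: H; apply: is_subring1. Qed.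

Lemma st_mono E F : nz_submod R E -> nz_submod R F -> E `<=` F -> st E `<=` st F.
Proof. by move=> nE nF; have [] := sst nE nF. Qed.

Lemma st_eq_of1 J : nz_submod R J -> J `<=` R -> st J 1 -> st J = st R.
Proof.
move=> nJ JR J1; have [[sJ nJ'] _ _ _ JJ] := sst nJ nJ.
apply/seteqP; split; first exact: st_mono.
rewrite -JJ; apply: st_mono => // x Rx; rewrite -[x]mulr1.
by case: sJ => _ _; apply.
Qed.

Lemma nz_fg_homog_nz J : nz_fg_homog_ideal R C J -> nz_submod R J.
Proof. by move=> [[sJ _ _] _ nJ]. Qed.

Lemma RH_comp_mul_comp (s : seq G) (f : G -> K) b y : uniq s ->
  (forall a, a \in s -> RH_comp C a (f a)) -> C b y ->
  R ((\sum_(a <- s) f a) * y) -> forall a, a \in s -> R (f a * y).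
Proof.
move=> us Af Cy Rxy a sa.
have [z1 [z2 [H1 H2 ez]]] := hsum_split [set a + b] (comp_decomposes gdR Rxy).
have {}H1 : hsum C [set a + b] z1 by apply: hsum_mono H1 => c [].
have {}H2 : hsum C [set c | c <> a + b] z2 by apply: hsum_mono H2 => c [].
suff -> : f a * y = z1.
  by apply: (comp_sub gdR (a := a + b)); apply: hsum1_comp H1 => c; apply: comp_subgrp gdR c.
apply: (hsum_compare (P := [set a + b]) (x' := (\sum_(c <- s | c != a) f c) * y) (y' := z2)
  (RH_comp_subgrp gdR) (RH_comp_direct gdR)).
- apply: (hsum_homog (a := a + b)) => //; apply: (RH_compM gdR); first exact: Af.
  exact: comp_RH_comp gdR _ _ Cy.
- exact: (comp_hsum_RH gdR).
- rewrite big_seq_cond mulr_suml.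
  apply: (subgrp_sum (hsum_subgrp _ (RH_comp_subgrp gdR))) => c /andP [sc ca].
  apply: (hsum_homog (a := c + b)).
    by apply: (RH_compM gdR); [apply: Af | apply: comp_RH_comp gdR _ _ Cy].
  by move=> /addIr cE; rewrite cE eqxx in ca.
- exact: (comp_hsum_RH gdR).
- by rewrite -mulrDl -ez (bigD1_seq a).
Qed.

(** As x y0 lies in [R], x = (x y0) / y0 has components in R_H; by [RH_comp_mul_comp] each of them
    multiplies every homogeneous generator into [R]. *)
Lemma colon_decomposes (s : seq K) x : (forall y, y \in s -> exists b, C b y) ->
  (exists2 y, y \in s & y != 0) -> colon R (gen R s) x ->
  hsum (fun a => RH_comp C a `&` colon R (gen R s)) setT x.
Proof.
move=> Hs [y0 sy0 y0n0] cx; have [b0 Cy0] := Hs _ sy0.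
have [l [Hl exy]] := comp_decomposes gdR (cx y0 (gen_mem rR sy0)).
have Hx : hsum (RH_comp C) setT x.
  have -> : x = (x * y0) * y0^-1 by rewrite mulfK.
  rewrite exy; apply: (hsumM (P1 := setT) (P2 := setT) (E1 := C)
    (E2 := fun b => [set z | RH_comp C b z])) => //.
  - move=> a b u v /(comp_RH_comp gdR) Au Av; exact: (RH_compM gdR).
  - by exists l.
  - apply: (hsum_homog (a := - b0)) => //; apply: (RH_compV gdR).
    exact: comp_RH_comp gdR _ _ Cy0.
have [t [f [ut Af ex]]] := hsum_uniq (RH_comp_subgrp gdR) Hx.
exists [seq (a, f a) | a <- t]; split; last by rewrite big_map.
move=> _ /mapP [a ta ->] /=; split=> //; split; first by have [] := Af a ta.
apply: colon_genP => // y sy; have [b Cy] := Hs y sy.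
apply: (RH_comp_mul_comp ut) (Cy) _ _ ta => [c /Af [] //|].
by rewrite -ex; apply: cx; apply: gen_mem.
Qed.

(** Finitely many elements of (R : I) occur in y; replacing them by their components, which stay in
    (R : I), puts y into an ideal with homogeneous generators. *)
Lemma colon_product_homog (s : seq K) y : (forall z, z \in s -> exists b, C b z) ->
  (exists2 z, z \in s & z != 0) -> prodm (gen R s) (colon R (gen R s)) y ->
  exists u : seq K, (forall b, b \in u -> colon R (gen R s) b /\ exists a, RH_comp C a b) /\
    gen R [seq a * b | a <- s, b <- u] y.
Proof.
move=> Hs sn0 [l [Hl ->]].
elim: l Hl => [|p l IH] Hl.
  by exists [::]; split=> //; rewrite big_nil; case: (gen_submod [seq a * b | a <- s, b <- [::]] rR).
have [|u [Hu gu]] := IH; first by move=> q ql; apply: Hl; rewrite inE ql orbT.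
have [gp cp] := Hl p (mem_head _ _).
have [k [Hk ek]] := colon_decomposes Hs sn0 cp.
pose u' := map snd k ++ u; exists u'; split.
  move=> b; rewrite mem_cat => /orP [/mapP [q /Hk [_ [Aq cq]] ->]|/Hu //].
  by split=> //; exists q.1.
rewrite big_cons; set W := gen R _.
have sW : is_submod R W by apply: gen_submod.
have gW := is_submod_subgrp rR sW.
apply: (subgrpD gW); last first.
  apply: gen_subset gu => // _ /allpairsP [[a b] /= [sa ub ->]].
  by apply/allpairsP; exists (a, b); rewrite /= mem_cat ub orbT.
rewrite ek mulr_sumr; apply: (subgrp_sum_seq gW) => q qk; rewrite mulrC.
apply: (gen_sub (scale_submod q.2 sW)) gp => a sa /=.
apply: gen_mem => //; apply/allpairsP; exists (a, q.2); rewrite /= mulrC.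
by rewrite mem_cat map_f.
Qed.

Lemma comp_colon_products (s u : seq K) : (forall y, y \in s -> exists b, C b y) ->
  (forall b, b \in u -> colon R (gen R s) b /\ exists a, RH_comp C a b) ->
  forall y, y \in [seq a * b | a <- s, b <- u] -> exists b, C b y.
Proof.
move=> Cs Hu _ /allpairsP [[a b] /= [sa ub ->]].
have [[e Ca] [cb [e' Ab]]] := (Cs a sa, Hu b ub).
exists (e + e'); apply: (RH_comp_R gdR).
  by apply: (RH_compM gdR) => //; apply: comp_RH_comp gdR _ _ Ca.
by rewrite mulrC; apply: cb; apply: gen_mem.
Qed.

(** A homogeneous denominator h moves the list into [R]. Invertibility there gives a finitely
    generated ideal inside I (R : I) whose closure contains 1; it is enlarged to one generated by
    homogeneous products, and h is moved over to [u]. The outcome is an ideal of [R] to which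
    linkedness can be applied. *)
Lemma GPstarMD_inverse : GPstarMD R C st -> forall s : seq K,
  (forall x, x \in s -> exists a, RH_comp C a x) -> (exists2 x, x \in s & x != 0) ->
  exists u : seq K, let J := gen R [seq a * b | a <- s, b <- u] in
    nz_fg_homog_ideal R C J /\ st J = st R.
Proof.
move=> P1 s As [x0 sx0 x0n0].
have [d dP] : {d : K -> G & forall x, x \in s -> RH_comp C (d x) x}.
  apply: (choice (P := fun x a => x \in s -> RH_comp C a x)) => x.
  by have [/As [a Aa]|_] := boolP (x \in s); [exists a | exists 0].
have [h [g [Ch hn0 Hh]]] := RH_comp_common_denominator gdR (d := d) (f := id) dP.
pose hs := [seq h * x | x <- s].
have Chs y : y \in hs -> exists b, C b y by move=> /mapP [x /Hh Cx ->]; exists (g + d x).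
have hsn0 : exists2 y, y \in hs & y != 0.
  by exists (h * x0); [apply: map_f | rewrite mulf_neq0].
have nF : nonzero (gen R hs).
  by have [y hy yn0] := hsn0; exists y; split=> //; apply: gen_mem.
have : star_f R st (prodm (gen R hs) (colon R (gen R hs))) 1.
  rewrite P1; first exact: st1.
  by split=> //; [apply: gen_homog_idealR gdR _ Chs | exists hs].
move=> [F' [[s' eF'] nF' F'sub stF']].
have [u [Hu gu]] : exists u : seq K,
    (forall b, b \in u -> colon R (gen R hs) b /\ exists a, RH_comp C a b) /\
    forall y, y \in s' -> gen R [seq a * b | a <- hs, b <- u] y.
  have : forall y, y \in s' -> prodm (gen R hs) (colon R (gen R hs)) y.
    by move=> y ys'; apply: F'sub; rewrite eF'; apply: gen_mem.
  elim: s' {eF'} => [|y s' IH] Hs'; first by exists [::].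
  have [|u [Hu gu]] := IH; first by move=> z zs; apply: Hs'; rewrite inE zs orbT.
  have [v [Hv gv]] := colon_product_homog Chs hsn0 (Hs' y (mem_head _ _)).
  exists (v ++ u); split; first by move=> b; rewrite mem_cat => /orP [/Hv|/Hu].
  move=> z; rewrite inE => /orP [/eqP ->|/gu].
    apply: gen_subset gv => // _ /allpairsP [[a b] /= [sa ub ->]].
    by apply/allpairsP; exists (a, b); rewrite /= mem_cat ub.
  apply: gen_subset => // _ /allpairsP [[a b] /= [sa ub ->]].
  by apply/allpairsP; exists (a, b); rewrite /= mem_cat ub orbT.
exists [seq h * b | b <- u]; set J := gen R _.
have eJ : J = gen R [seq a * b | a <- hs, b <- u].
  apply/seteqP; split; apply: gen_subset => // _ /allpairsP [[a b] /= [sa ub ->]].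
    move/mapP: ub => [b' ub' ->]; apply/allpairsP; exists (h * a, b').
    by split=> //; [apply: map_f | rewrite /= mulrCA mulrA].
  move/mapP: sa => [a' sa' ->]; apply/allpairsP; exists (a', h * b).
  by split=> //; [apply: map_f | rewrite /= mulrCA mulrA].
rewrite eJ; set W := [seq _ | a <- hs, b <- u].
have CW := comp_colon_products Chs Hu.
have F'W : F' `<=` gen R W by rewrite eF'; apply: gen_sub => //; apply: gen_submod.
have nW : nz_fg_homog_ideal R C (gen R W).
  split; [exact: gen_homog_idealR gdR _ CW | by exists W |].
  by have [y [yn0 Fy]] := nF'; exists y; split=> //; apply: F'W.
split=> //; apply: st_eq_of1; first exact: nz_fg_homog_nz.
  by have [[]] := nW.
apply: (st_mono _ _ F'W) => //; last exact: nz_fg_homog_nz.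
by split=> //; rewrite eF'; apply: gen_submod.
Qed.

Lemma prodm_gen_sub T x (W : seq K) : is_subring T -> R `<=` T ->
  (forall w, w \in W -> T (x * w)) -> forall y, prodm (gen R W) T y -> T (x * y).
Proof.
move=> rT RT HW; apply: (prodm_sub (subgrp_scale x (is_subring_subgrp rT))).
move=> y t gy Tt /=; rewrite mulrA; apply: is_subringM => //.
by move: y gy; apply: gen_sub => //; apply: (scale_submod x); apply: is_submod_refl.
Qed.

(** With J from [GPstarMD_inverse], linkedness makes J T have t-closure [T]; an x that multiplies
    all products a b into [T] multiplies J T into [T], hence lies in [T]. *)
Lemma GPstarMD_PvMD T : GPstarMD R C st -> homog_linked R C st T (t_op T) -> PvMD T.
Proof.
move=> P1 [oT lT]; have [rT RT _ _] := oT; apply: (PvMD_of_homogeneous gdR oT) => s Hs sn0.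
have As x : x \in s -> exists a, RH_comp C a x by move=> /Hs [a [_ Aa]]; exists a.
have [u [nJ stJ]] := GPstarMD_inverse P1 As sn0; exists u; split=> [a b sa ub|x Hx].
  apply: RT; have [[_ JR _] _ _] := nJ; apply: JR.
  by apply: gen_mem => //; apply/allpairsP; exists (a, b).
apply: (t_op1_colon (E := prodm (gen R [seq a * b | a <- s, b <- u]) T)).
  by rewrite lT //; apply: t_op1.
apply: prodm_gen_sub => // _ /allpairsP [[a b] /= [sa ub ->]]; exact: Hx.
Qed.

Lemma GPstarMD_graded_Prufer T : GPstarMD R C st -> homog_linked R C st T (@d_op K) ->
  graded_Prufer C T.
Proof.
move=> P1 [oT lT] I [hI fI nI]; have [rT RT _ _] := oT.
have [s [Es eI]] := homog_generators rT hI fI.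
have sn0 : exists2 x, x \in s & x != 0 by apply: (@gen_nonzero _ T); rewrite -eI.
have As x : x \in s -> exists a, RH_comp C a x by move=> /Es [a [_ Aa]]; exists a.
have [u [nJ stJ]] := GPstarMD_inverse P1 As sn0.
have sP : is_submod T (prodm I (colon T I)) by apply: prodm_submod; case: hI.
apply/seteqP; split; first exact: prodm_colon_sub.
have JT := lT _ nJ stJ; rewrite /d_op in JT; rewrite -{1}JT.
apply: prodm_sub; first exact: is_submod_subgrp sP.
move=> y t gy Tt; rewrite mulrC; case: (sP) => _ _; apply=> //.
have sPR : is_submod R (prodm I (colon T I)).
  by case: sP => P0 PD PM; split=> // r x /RT; apply: PM.
move: y gy; apply: (gen_sub sPR) => _ /allpairsP [[a b] /= [sa ub ->]].
apply: prodm_mem; first by rewrite eI; apply: gen_mem.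
rewrite eI; apply: colon_genP => // c sc; rewrite mulrC; apply: RT.
have [[_ JR _] _ _] := nJ; apply: JR.
by apply: gen_mem => //; apply/allpairsP; exists (c, b).
Qed.

Lemma homog_linked_d_t T : homog_linked R C st T (@d_op K) -> homog_linked R C st T (t_op T).
Proof. by move=> [oT lT]; split=> // F nF stF; congr (t_op T _); apply: lT. Qed.

End Semistar.

(** * Localization at a homogeneous prime *)

Section Converse.
Local Open Scope ring_scope.
Variables (K : fieldType) (G : zmodType) (Gam : set G) (R : set K) (C : G -> set K).
Variable st : set K -> set K.
Hypothesis gdR : graded_domain Gam R C.
Hypothesis sst : is_semistar R st.

Let rR : is_subring R. Proof. exact: graded_subringR gdR. Qed.
Let gR : subgrp R. Proof. exact: is_subring_subgrp. Qed.

Definition st_unit J := nz_fg_homog_ideal R C J /\ st J = st R.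

Lemma st_unitR : st_unit R.
Proof.
have sR : is_submod R R by apply: is_submod_refl.
have eR : R = gen R [:: 1].
  apply/seteqP; split; last first.
    by apply: gen_sub => // x; rewrite inE => /eqP ->; apply: is_subring1.
  move=> x Rx; rewrite -[x]mulr1; case: (gen_submod [:: 1] rR) => _ _; apply=> //.
  by apply: gen_mem; rewrite ?inE.
split=> //; split; last by exists 1; rewrite oner_neq0; split=> //; apply: is_subring1.
  rewrite {2}eR; apply: (gen_homog_idealR gdR) => x; rewrite inE => /eqP ->.
  by exists 0; apply: comp1 gdR.
by exists [:: 1].
Qed.

(** Let W be the product. For a nonzero generator a of [J1], st W contains st (a J2) = a st J2,
    hence a, because 1 lies in st J2. So st W contains [J1], and by idempotence st J1, which
    contains 1. *)
Lemma st_unitM J1 J2 : st_unit J1 -> st_unit J2 ->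
  exists J, st_unit J /\ J `<=` prodm J1 J2.
Proof.
move=> [[h1 f1 n1] st1J] [[h2 f2 n2] st2J].
have [s1 [C1 e1]] := homog_generators rR h1 f1.
have [s2 [C2 e2]] := homog_generators rR h2 f2.
pose W := [seq a * b | a <- s1, b <- s2].
have CW y : y \in W -> exists b, C b y.
  move=> /allpairsP [[a b] /= [/C1 [c Ca] /C2 [d Cb] ->]].
  by exists (c + d); apply: (compM gdR).
have nW : nz_fg_homog_ideal R C (gen R W).
  split; [exact: gen_homog_idealR gdR _ CW | by exists W |].
  have [a sa an0] : exists2 a, a \in s1 & a != 0 by apply: (@gen_nonzero _ R); rewrite -e1.
  have [b sb bn0] : exists2 b, b \in s2 & b != 0 by apply: (@gen_nonzero _ R); rewrite -e2.
  exists (a * b); split; first by rewrite mulf_neq0.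
  by apply: gen_mem => //; apply/allpairsP; exists (a, b).
have nzW := nz_fg_homog_nz nW.
have [nzstW _ _ _ ststW] := sst nzW nzW.
have sW : is_submod R (gen R W) by apply: gen_submod.
exists (gen R W); split; last first.
  apply: gen_sub; first by apply: prodm_submod; case: h1.
  move=> _ /allpairsP [[a b] /= [sa sb ->]].
  by apply: prodm_mem; rewrite ?e1 ?e2; apply: gen_mem.
split=> //; apply: (st_eq_of1 gdR sst) => //; first by case: nW => [[]].
have nz1 : nz_submod R J1 by split=> //; case: h1.
have nz2 : nz_submod R J2 by split=> //; case: h2.
rewrite -ststW; have : st J1 1 by rewrite st1J; apply: (st1 gdR sst).
apply: (st_mono sst) => //; rewrite e1; apply: gen_sub; first by case: nzstW.
move=> a sa; have [->|an0] := eqVneq a 0; first by case: nzstW => [[]].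
have nza : nz_submod R (smul a J2).
  case: nz2 => [[z2 D2 M2] [y [yn0 Jy]]]; split; first split.
  - by exists 0; rewrite ?mulr0.
  - by move=> _ _ [x Jx ->] [z Jz ->]; exists (x + z); rewrite ?mulrDr //; apply: D2.
  - by move=> r _ Rr [x Jx ->]; exists (r * x); [apply: M2 | rewrite mulrCA].
  - by exists (a * y); split; [rewrite mulf_neq0 | exists y].
have aW : smul a J2 `<=` gen R W.
  move=> _ [y Jy ->]; move: Jy; rewrite e2; apply: (gen_sub (scale_submod a sW)) => b sb /=.
  by apply: gen_mem => //; apply/allpairsP; exists (a, b).
apply: (st_mono sst nza nzW aW).
have [_ -> // _ _ _] := sst nz2 nz2.
by exists 1; rewrite ?mulr1 // st2J; apply: (st1 gdR sst).
Qed.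

Definition avoids_units M := forall J, st_unit J -> ~ J `<=` M.

(** * A homogeneous ideal maximal among those containing no member of [st_unit] *)

Section Prime.
Variable I0 : set K.
Hypothesis hI0 : homog_ideal R C I0.
Hypothesis aI0 : avoids_units I0.

Let good M := [/\ homog_ideal R C M, I0 `<=` M & avoids_units M].

(** A finitely generated ideal inside the union of a chain lies in one member. The alternative
    [X = set0] provides for the empty chain in Zorn's lemma. *)
Let good_chain (F : set (set K)) : (forall X, F X -> X = set0 \/ good X) ->
  total_on F subset -> (exists X, F X /\ good X) -> good (\bigcup_(X in F) X).
Proof.
move=> FP totF [X0 [FX0 gX0]].
have inU x : (\bigcup_(X in F) X) x -> exists X, [/\ F X, good X & X x].
  by move=> [X FX Xx]; exists X; split=> //; case: (FP X FX) => // X00; rewrite X00 in Xx.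
have inU2 X Y : F X -> good X -> F Y -> good Y ->
    exists Z, [/\ F Z, good Z, X `<=` Z & Y `<=` Z].
  by move=> FX gX FY gY; case: (totF X Y FX FY) => XY; [exists Y | exists X]; split=> // z.
split.
- split; first split.
  + by exists X0 => //; case: gX0 => [[[]]].
  + move=> x y /inU [X [FX gX Xx]] /inU [Y [FY gY Yy]].
    have [Z [FZ gZ XZ YZ]] := inU2 X Y FX gX FY gY; exists Z => //.
    by case: gZ => [[[_ ZD _] _ _] _ _]; apply: ZD; [apply: XZ | apply: YZ].
  + move=> r x Rr /inU [X [FX gX Xx]]; exists X => //.
    by case: gX => [[[_ _ XM] _ _] _ _]; apply: XM.
  + by move=> x /inU [X [FX [[_ XR _] _ _] /XR]].
  + move=> x /inU [X [FX [[_ _ dX] _ _] /dX [s [f [us Hf ex]]]]].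
    by exists s, f; split=> // a /Hf [Ca Xa]; split=> //; exists X.
- by move=> x I0x; exists X0 => //; case: gX0 => _ + _; apply.
- move=> J NJ JU; have [[_ [s eJ] _] _] := NJ.
  have [X [FX gX sX]] : exists X, [/\ F X, good X & forall x, x \in s -> X x].
    have : forall x, x \in s -> (\bigcup_(X in F) X) x.
      by move=> x xs; apply: JU; rewrite eJ; apply: gen_mem.
    elim: s {eJ} => [|x s IH] sU; first by exists X0.
    have [|X [FX gX sX]] := IH; first by move=> y ys; apply: sU; rewrite inE ys orbT.
    have [Y [FY gY Yx]] := inU _ (sU x (mem_head _ _)).
    have [Z [FZ gZ XZ YZ]] := inU2 X Y FX gX FY gY; exists Z; split=> // y.
    by rewrite inE => /orP [/eqP ->|/sX /XZ //]; apply: YZ.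
  have [[sbX _ _] _ aX] := gX; apply: (aX J NJ); rewrite eJ; exact: gen_sub.
Qed.

(** Take M maximal. If homogeneous a and b lie outside M, then M + R a and M + R b contain members
    of [st_unit], and the product of these contains another one; a b in M would put it inside M. *)
Lemma exists_prime : exists M, [/\ homog_ideal R C M, I0 `<=` M, avoids_units M &
  forall g g' a b, C g a -> C g' b -> M (a * b) -> M a \/ M b].
Proof.
have [F FP totF|M [PM maxM]] := @Zorn_bigcup K (fun X => X = set0 \/ good X).
  have [Fg|nFg] := pselect (exists X, F X /\ good X); first by right; apply: good_chain.
  left; rewrite -subset0 => x [X FX Xx]; case: (FP X FX) => [X0|gX]; first by rewrite X0 in Xx.
  by case: nFg; exists X.
have gM : good M.
  case: PM => // M0; exfalso; apply: (maxM I0); last by right; split.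
  rewrite M0; split=> // /(_ 0); apply; by case: hI0 => [[]].
have [[sM MR dM] IM aM] := gM; exists M; split=> //.
have gpM := is_submod_subgrp rR sM; have [M0 MD MM] := sM.
pose adj (a : K) : set K := [set x | exists m r, [/\ M m, R r & x = m + r * a]].
have adjP g a : C g a -> ~ M a -> exists2 J, st_unit J & J `<=` adj a.
  move=> Ca nMa; have Ra := comp_sub gdR Ca.
  apply: contrapT => nJ; apply: (maxM (adj a)).
    split; last first.
      move=> sub; apply: nMa; apply: sub; exists 0, 1; rewrite mul1r add0r; split=> //.
      exact: is_subring1.
    by move=> m Mm; exists m, 0; rewrite mul0r addr0; split=> //; apply: subgrp0.
  right; split; last by move=> J NJ Ja; apply: nJ; exists J.
    have sa : is_submod R (adj a).
      split.
      - by exists 0, 0; rewrite mul0r addr0; split=> //; apply: subgrp0.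
      - move=> _ _ [m [r [Mm Rr ->]]] [n [t [Mn Rt ->]]]; exists (m + n), (r + t).
        by split; [apply: MD | apply: subgrpD | rewrite mulrDl addrACA].
      - move=> t _ Rt [m [r [Mm Rr ->]]]; exists (t * m), (t * r).
        by split; [apply: MM | apply: is_subringM | rewrite mulrDr mulrA].
    have gE c : subgrp (C c `&` adj a).
      have ga := is_submod_subgrp rR sa; have gc := comp_subgrp gdR c.
      split=> [|x y [Cx ax] [Cy ay]]; first by split; apply: subgrp0.
      by split; apply: subgrpB.
    split=> //.
      move=> _ [m [r [Mm Rr ->]]]; apply: (subgrpD gR); first exact: MR.
      exact: is_subringM.
    move=> _ [m [r [Mm Rr ->]]]; apply: (hsum_decomposes (P := setT) gE); apply: hsumD.
      have [s [f [us Hf ->]]] := dM m Mm; exists [seq (c, f c) | c <- s].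
      split; last by rewrite big_map.
      move=> _ /mapP [c sc ->] /=; have [Cc Mc] := Hf c sc; split=> //; split=> //.
      by exists (f c), 0; rewrite mul0r addr0; split=> //; apply: subgrp0.
    have [l [Hl ->]] := comp_decomposes gdR Rr.
    exists [seq (p.1 + g, p.2 * a) | p <- l]; split; last by rewrite big_map mulr_suml.
    move=> _ /mapP [p /Hl [_ Cp] ->] /=; split=> //; split; first exact: (compM gdR).
    exists 0, p.2; rewrite add0r; split=> //; exact: (comp_sub gdR Cp).
  by move=> x /IM Mx; exists x, 0; rewrite mul0r addr0; split=> //; apply: subgrp0.
move=> g g' a b Ca Cb Mab.
have [Ma|nMa] := pselect (M a); [by left | have [Mb|nMb] := pselect (M b); first by right].
have [J1 N1 J1a] := adjP g a Ca nMa; have [J2 N2 J2b] := adjP g' b Cb nMb.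
have [J [NJ JJ]] := st_unitM N1 N2; exfalso; apply: (aM J NJ).
apply: (subset_trans JJ); apply: (prodm_sub gpM) => x y.
move=> /J1a [m [r [Mm Rr ->]]] /J2b [n [t [Mn Rt ->]]].
have [Ra Rb] := (comp_sub gdR Ca, comp_sub gdR Cb).
have -> : (m + r * a) * (n + t * b) = (n + t * b) * m + (r * a) * n + (r * t) * (a * b) by ring.
have Rn := MR _ Mn.
apply: (subgrpD gpM); [apply: (subgrpD gpM)|]; apply: MM => //; try by apply: is_subringM.
by apply: (subgrpD gR) => //; apply: is_subringM.
Qed.

End Prime.

(** * Inverting the homogeneous elements outside M *)

Section Localization.
Variable M : set K.
Hypothesis hM : homog_ideal R C M.
Hypothesis aM : avoids_units M.
Hypothesis pM : forall g g' a b, C g a -> C g' b -> M (a * b) -> M a \/ M b.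

Let sM : is_submod R M. Proof. by case: hM. Qed.

Definition hcompl : set K := [set s | (exists g, C g s) /\ ~ M s].

Let hcompl_n0 s : hcompl s -> s != 0.
Proof. by move=> [_ nMs]; apply: contra_notN nMs => /eqP ->; case: sM. Qed.

Let hcompl1 : hcompl 1.
Proof.
split=> [|M1]; first by exists 0; apply: comp1 gdR.
apply: (aM st_unitR) => x Rx; rewrite -[x]mulr1; by case: sM => _ _; apply.
Qed.

Let hcomplM s t : hcompl s -> hcompl t -> hcompl (s * t).
Proof.
move=> [[g Cs] Ms] [[g' Ct] Mt]; split; first by exists (g + g'); apply: (compM gdR).
by move/(pM Cs Ct) => [].
Qed.

Let hcomplR s : hcompl s -> R s.
Proof. by move=> [[g Cs] _]; apply: (comp_sub gdR Cs). Qed.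

Definition hloc : set K := [set x | exists a s, [/\ R a, hcompl s & x = a / s]].

Let R_hloc : R `<=` hloc.
Proof. by move=> x Rx; exists x, 1; rewrite divr1. Qed.

Let rT : is_subring hloc.
Proof.
split.
- by apply: R_hloc; apply: subgrp0.
- by apply: R_hloc; apply: is_subring1.
- move=> _ _ [a [s [Ra Ss ->]]] [b [t [Rb St ->]]].
  exists (a * t - b * s), (s * t); split; last first.
    by field; rewrite !hcompl_n0.
  + exact: hcomplM.
  + by apply: (subgrpB gR); apply: is_subringM => //; apply: hcomplR.
- move=> _ _ [a [s [Ra Ss ->]]] [b [t [Rb St ->]]].
  exists (a * b), (s * t); split; [exact: is_subringM | exact: hcomplM |].
  by field; rewrite !hcompl_n0.
Qed.
Let gT : subgrp hloc. Proof. exact: is_subring_subgrp. Qed.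

Lemma hloc_overring : homog_overring R C hloc.
Proof.
split=> //.
  move=> _ [a [s [Ra Ss ->]]]; have [[g Cs] Ms] := Ss.
  by exists a, s, g; split=> //; apply: hcompl_n0.
move=> _ [a [s [Ra Ss ->]]]; have [[g Cs] Ms] := Ss; have sn0 := hcompl_n0 Ss.
apply: (hsum_decomposes (P := setT)) => [c|]; first exact: (over_comp_subgrp gdR).
have [l [Hl ->]] := comp_decomposes gdR Ra.
exists [seq (p.1 - g, p.2 / s) | p <- l]; split; last by rewrite big_map mulr_suml.
move=> _ /mapP [p /Hl [_ Cp] ->] /=; split=> //; split.
  by exists p.2, s; split=> //; apply: (comp_sub gdR Cp).
apply: (RH_compM gdR); first exact: comp_RH_comp gdR _ _ Cp.
by apply: (RH_compV gdR); apply: comp_RH_comp gdR _ _ Cs.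
Qed.

(** An ideal F with st F = st R is not contained in M, so one of its homogeneous generators is
    invertible in [T]. *)
Lemma hloc_linked T : homog_overring R C T -> hloc `<=` T -> homog_linked R C st T (@d_op K).
Proof.
move=> oT lT; have [rT' RT _ _] := oT; split=> // F nF stF; rewrite /d_op.
have [[sF FR dF] fF n_F] := nF.
have [s [Cs eF]] : exists s, (forall x, x \in s -> exists a, C a x) /\ F = gen R s.
  by apply: homog_generators fF => //; split.
have [f sf nMf] : exists2 f, f \in s & ~ M f.
  apply: contrapT => nf; apply: (aM (J := F)); first by split.
  rewrite eF; apply: gen_sub => // x xs; apply: contrapT => nMx; apply: nf; by exists x.
have Sf : hcompl f by split=> //; apply: Cs.
apply/seteqP; split.
  apply: prodm_sub; first exact: is_subring_subgrp.
  by move=> x y /FR /RT Tx Ty; apply: is_subringM.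
move=> t Tt; have -> : t = f * (f^-1 * t) by rewrite mulrA mulfV ?mul1r // hcompl_n0.
apply: prodm_mem; first by rewrite eF; apply: gen_mem.
apply: is_subringM => //; apply: lT; exists 1, f; rewrite mul1r; split=> //.
exact: is_subring1.
Qed.

Let unitT x := x != 0 /\ hloc x^-1.

Let homog_unit a x : RH_comp C a x -> hloc x -> unitT x \/ exists m s, [/\ M m, hcompl s & x = m / s].
Proof.
move=> Ax [m [s [Rm Ss ex]]]; have [[g Cs] _] := Ss; have sn0 := hcompl_n0 Ss.
have [Mm|nMm] := pselect (M m); [by right; exists m, s | left].
have em : m = x * s by rewrite ex divfK.
have Sm : hcompl m.
  split=> //; exists (a + g); apply: (RH_comp_R gdR) => //.
  by rewrite em; apply: (RH_compM gdR) => //; apply: comp_RH_comp gdR _ _ Cs.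
split; first by rewrite ex mulf_neq0 ?invr_eq0 // hcompl_n0.
by rewrite ex invf_div; exists s, m; split=> //; apply: hcomplR.
Qed.

(** A homogeneous nonunit has a numerator in M. If x and y were both nonunits, clearing denominators
    in (x + y) (e / r) = 1 would put s t r, a product of homogeneous elements outside M, into M. *)
Lemma hloc_local a x y : RH_comp C a x -> RH_comp C a y -> hloc x -> hloc y ->
  unitT (x + y) -> unitT x \/ unitT y.
Proof.
move=> Ax Ay Tx Ty [xyn0 [e [r [Re Sr exy]]]].
have [|[m [s [Mm Ss ex]]]] := homog_unit Ax Tx; first by left.
have [|[n [t [Mn Tt ey]]]] := homog_unit Ay Ty; first by right.
have [s0 t0 r0] : [/\ s != 0, t != 0 & r != 0] by split; apply: hcompl_n0.
have [_ []] := hcomplM (hcomplM Ss Tt) Sr.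
have -> : s * t * r = (t * e) * m + (s * e) * n.
  have : (x + y) * (e / r) = 1 by rewrite -exy mulfV.
  rewrite ex ey => /(congr1 (fun z => z * (s * t * r))); rewrite mul1r => <-.
  by field; rewrite s0 t0 r0.
case: sM => _ MD MM; apply: MD; apply: MM => //; apply: is_subringM => //; exact: hcomplR.
Qed.

(* Seidenberg's argument: the leading coefficient times [u] is integral, so it can be absorbed into
   the next coefficient, which lowers the degree while keeping a unit among the coefficients. *)
Lemma unit_coef_root (al be : G) (u : K) (P : {poly K}) : int_closed hloc ->
  RH_comp C al u -> u != 0 ->
  (forall k, hloc P`_k /\ RH_comp C (be - al *+ k) P`_k) -> root P u ->
  (exists k, unitT P`_k) -> hloc u \/ hloc u^-1.
Proof.
move=> icT Au un0; have [n] := ubnP (size P); elim: n P => // n IH P sP HP rP [k Uk].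
have Pn0 : P != 0 by apply/eqP => P0; case: Uk; rewrite P0 coef0 eqxx.
have sP1 := root_size_gt1 Pn0 rP.
pose m := (size P).-2; have sPm : size P = m.+2 by rewrite /m; case: (size P) sP1 => [|[]].
pose lc := P`_m.+1; pose v := lc * u.
have [Tlc Alc] := HP m.+1.
have lc0 : lc != 0 by rewrite /lc -[m.+1]/(m.+2.-1) -sPm -lead_coefE lead_coef_eq0.
have Tv : hloc v.
  (* This is lc^m P(X / lc): monic, with coefficients in [hloc] and with the root lc u. *)
  pose q := \poly_(i < m.+2) (if i == m.+1 then 1 else P`_i * lc ^+ (m - i)).
  apply: (icT q).
  - apply/monicP; rewrite lead_coef_poly ?eqxx ?oner_neq0 //.
  - move=> i; rewrite coef_poly; case: ifP => _; last exact: subgrp0.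
    case: ifP => _; first exact: is_subring1.
    by apply: is_subringM => //; [have [] := HP i | apply: is_subringX].
  - apply/rootP; rewrite horner_poly.
    transitivity (lc ^+ m * P.[u]); last by move/rootP: rP => ->; rewrite mulr0.
    rewrite horner_coef sPm mulr_sumr; apply: eq_bigr => i _; rewrite /v exprMn.
    case: eqP => [->|/eqP im]; first by rewrite mul1r exprS /lc; ring.
    have im' : (i <= m)%N by rewrite -ltnS ltn_neqAle im -ltnS ltn_ord.
    have -> : lc ^+ m = lc ^+ (m - i) * lc ^+ i by rewrite -exprD subnK.
    by ring.
have Av : RH_comp C (be - al *+ m) v.
  have := RH_compM gdR Alc Au; congr RH_comp.
  by rewrite mulrSr opprD addrA subrK.
pose P' := P - lc *: 'X^(m.+1) + v *: 'X^m.
have eP' i : P'`_i = if i == m.+1 then 0 else P`_i + if i == m then v else 0.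
  rewrite coefD coefB !coefZ !coefXn; case: (eqVneq i m.+1) => [->|_].
    by rewrite mulr1 subrr (gtn_eqF (ltnSn m)) mulr0 addr0.
  by rewrite mulr0 subr0; case: eqP => _; rewrite ?mulr1 ?mulr0.
have rP' : root P' u.
  apply/rootP; rewrite !hornerE; move/rootP: rP => ->.
  by rewrite /v exprS; ring.
have sP' : (size P' < n)%N.
  apply: (@leq_ltn_trans m.+1); last by rewrite sPm ltnS in sP.
  apply/leq_sizeP => j; rewrite eP' leq_eqVlt => /orP [/eqP <-|mj]; first by rewrite eqxx.
  by rewrite (gtn_eqF mj) (gtn_eqF (ltnW mj)) addr0 nth_default // sPm.
have HP' i : hloc P'`_i /\ RH_comp C (be - al *+ i) P'`_i.
  have gA := RH_comp_subgrp gdR (be - al *+ i).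
  rewrite eP'; case: eqP => _; first by split; [apply: subgrp0 | apply: (subgrp0 gA)].
  have [TP AP] := HP i.
  split; [apply: (subgrpD gT) => // | apply: (subgrpD gA) => //].
    by case: eqP => _ //; apply: subgrp0.
  by case: eqP => [->|_] //; apply: (subgrp0 gA).
have km : (k <= m.+1)%N.
  rewrite leqNgt; apply/negP => mk; by case: Uk => /eqP + _; apply; rewrite nth_default // sPm.
(* If the leading coefficient is a unit, u = v / lc. A unit below degree m survives in [P']. In
   degree m the unit is P'_m - v, so by [hloc_local] either P'_m is a unit and the induction
   applies, or v is one and u^-1 = lc / v. *)
have [km1|km1] := eqVneq k m.+1.
  left; have -> : u = v * lc^-1 by rewrite /v mulrAC mulfV ?mul1r.
  by apply: is_subringM => //; rewrite /lc -km1; case: Uk.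
have [ekm|nkm] := eqVneq k m; last first.
  by apply: (IH P') => //; exists k; rewrite eP' (negbTE km1) (negbTE nkm) addr0.
have [TP'm AP'm] := HP' m.
have ePm : P`_m = P'`_m + (- v).
  by rewrite eP' (ltn_eqF (ltnSn m)) eqxx addrK.
have [||Um|[_ Uv]] := hloc_local AP'm (subgrpN (RH_comp_subgrp gdR _) Av) TP'm.
- exact: (subgrpN gT).
- by rewrite -ePm -ekm.
- by apply: (IH P') => //; exists m.
right; have -> : u^-1 = - lc * (- v)^-1 by rewrite /v invrN mulrNN invfM mulVKf.
by apply: is_subringM => //; apply: (subgrpN gT).
Qed.

(** * Comparability of homogeneous elements in R_M *)

Section Valuation.
Hypothesis icT : forall T, homog_overring R C T -> hloc `<=` T -> int_closed T.

Definition adjoin_sq (u : K) : set K :=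
  [set x | exists p : {poly K}, (forall i, hloc p`_i) /\ x = p.[u ^+ 2]].

Let hloc_adjoin_sq u : hloc `<=` adjoin_sq u.
Proof.
move=> x Tx; exists x%:P; rewrite hornerC; split=> // i; rewrite coefC.
by case: ifP => _ //; apply: subgrp0.
Qed.

Let RH_subring : is_subring (RH C R).
Proof.
split.
- by exists 0, 1, 0; rewrite mul0r oner_neq0; split=> //; [apply: subgrp0 | apply: comp1 gdR].
- exists 1, 1, 0; rewrite divr1 oner_neq0; split=> //; [exact: is_subring1 | exact: comp1 gdR].
- move=> _ _ [a [h [g [Ra Ch hn0 ->]]]] [b [k [g' [Rb Ck kn0 ->]]]].
  exists (a * k - b * h), (h * k), (g + g'); split.
  + by apply: (subgrpB gR); apply: is_subringM => //; apply: comp_sub gdR _ _ _; eassumption.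
  + exact: (compM gdR).
  + by rewrite mulf_neq0.
  + by field; rewrite hn0 kn0.
- move=> _ _ [a [h [g [Ra Ch hn0 ->]]]] [b [k [g' [Rb Ck kn0 ->]]]].
  exists (a * b), (h * k), (g + g'); split; [exact: is_subringM | exact: (compM gdR) | |].
  + by rewrite mulf_neq0.
  + by field; rewrite hn0 kn0.
Qed.

Let RH_comp_RH a x : RH_comp C a x -> RH C R x.
Proof.
by move=> [b [g [p [h [Cp Ch hn0 _ ->]]]]]; exists p, h, g; split=> //; apply: (comp_sub gdR Cp).
Qed.

Let adjoin_sq_overring al u : RH_comp C al u -> homog_overring R C (adjoin_sq u).
Proof.
move=> Au; have [_ _ TRH dT] := hloc_overring.
have Au2 k := RH_compX gdR k Au.
have rU : is_subring (adjoin_sq u).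
  split.
  - by apply: hloc_adjoin_sq; apply: subgrp0.
  - by apply: hloc_adjoin_sq; apply: is_subring1.
  - move=> _ _ [p [Tp ->]] [q [Tq ->]]; exists (p - q); rewrite hornerD hornerN; split=> // i.
    by rewrite coefB; apply: (subgrpB gT).
  - move=> _ _ [p [Tp ->]] [q [Tq ->]]; exists (p * q); rewrite hornerM; split=> // i.
    by rewrite coefM; apply: (subgrp_sum gT) => j _; apply: is_subringM.
have Uu2 : adjoin_sq u (u ^+ 2).
  exists 'X; rewrite hornerX; split=> // i; rewrite coefX.
  by case: eqP => _; [apply: is_subring1 | apply: subgrp0].
split=> //.
- by move=> x /R_hloc; apply: hloc_adjoin_sq.
- move=> _ [p [Tp ->]]; rewrite horner_coef.
  apply: (subgrp_sum (is_subring_subgrp RH_subring)) => i _.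
  apply: (is_subringM RH_subring); first by apply: TRH.
  by apply: (is_subringX _ RH_subring); apply: (is_subringX _ RH_subring); apply: RH_comp_RH Au.
- move=> x [p [Tp ->]]; have gE c := over_comp_subgrp gdR c rU.
  apply: (hsum_decomposes (P := setT) gE); rewrite horner_coef.
  apply: (subgrp_sum (hsum_subgrp _ gE)) => i _; rewrite -exprM.
  apply: (hsumM (P1 := setT) (P2 := setT)
    (E1 := over_comp C hloc) (E2 := over_comp C (adjoin_sq u))) => //.
  + move=> a b y z [Ty Ay] [Uz Az]; apply: (over_compM gdR) => //; split=> //.
    exact: hloc_adjoin_sq.
  + exact: decomposes_hsum (dT _ (Tp i)).
  + apply: (hsum_homog (a := al *+ (2 * i))) => //; split; last exact: Au2.
    by rewrite exprM; apply: is_subringX.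
Qed.

(** As a root of X^2 - u^2, u is integral over R_M[u^2], so u = p(u^2) for some p over R_M. The
    polynomial X - p(X^2) has the root u and the coefficient 1 at X, since p(X^2) has even exponents
    only; [unit_coef_root] applies once p is made graded. *)
Lemma hloc_total al u : RH_comp C al u -> u != 0 -> hloc u \/ hloc u^-1.
Proof.
move=> Au un0; have [_ _ _ dT] := hloc_overring.
have gTA a := over_comp_subgrp gdR a rT.
have Auk k := RH_compX gdR k Au.
have [p [Tp eu]] : adjoin_sq u u.
  apply: (icT (adjoin_sq_overring Au) (@hloc_adjoin_sq u) (p := 'X^2 - (u ^+ 2)%:P)).
  - by rewrite monicXnsubC.
  - move=> i; rewrite coefB coefXn coefC.
    have [rU _ _ _] := adjoin_sq_overring Au; have gU := is_subring_subgrp rU.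
    apply: (subgrpB gU); first by case: eqP => _; [apply: is_subring1 | apply: subgrp0].
    case: eqP => _; last exact: subgrp0.
    exists 'X; rewrite hornerX; split=> // j; rewrite coefX.
    by case: eqP => _; [apply: is_subring1 | apply: subgrp0].
  - by rewrite /root !hornerE subrr.
(* Keeping only the component of degree al - 2 i al in the i-th coefficient makes every term of
   p(u^2) homogeneous of degree [al], the degree of u, and preserves the equation. *)
have [c cP] : {c : nat -> K & forall i, over_comp C hloc (al - al *+ (2 * i)) (c i) /\
    hsum (over_comp C hloc) [set a | a <> al - al *+ (2 * i)] (p`_i - c i)}.
  apply: (choice (P := fun i x => over_comp C hloc (al - al *+ (2 * i)) x /\
    hsum (over_comp C hloc) [set a | a <> al - al *+ (2 * i)] (p`_i - x))) => i.
  have [x [y [Hx Hy exy]]] :=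
    hsum_split [set al - al *+ (2 * i)] (decomposes_hsum (dT _ (Tp i))).
  exists x; split; last by rewrite exy addrAC subrr add0r; apply: hsum_mono Hy => a [].
  by apply: (hsum1_comp gTA); apply: hsum_mono Hx => a [].
pose Q := \poly_(i < size p) c i.
have eQ : u = Q.[u ^+ 2].
  apply: (hsum_compare (P := [set al]) (x' := 0) (y' := (p - Q).[u ^+ 2])
    (RH_comp_subgrp gdR) (RH_comp_direct gdR)).
  - exact: (hsum_homog Au).
  - rewrite /Q horner_poly; apply: (subgrp_sum (hsum_subgrp _ (RH_comp_subgrp gdR))) => i _.
    apply: (hsum_homog (a := al)) => //; have [[_ Ac] _] := cP i.
    by have := RH_compM gdR Ac (Auk (2 * i)%N); rewrite subrK exprM.
  - exact: hsum0.
  - rewrite hornerD hornerN /Q horner_poly horner_coef -sumrB.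
    apply: (subgrp_sum (hsum_subgrp _ (RH_comp_subgrp gdR))) => i _; rewrite -mulrBl -exprM.
    have [_ Hc] := cP i.
    apply: (hsumM (P2 := [set al *+ (2 * i)]) (E1 := over_comp C hloc) (E2 := RH_comp C) _ _ Hc).
    + by move=> a b y z [_ Ay] Az; apply: (RH_compM gdR).
    + by move=> a b /= na -> eab; apply: na; apply/eqP; rewrite eq_sym subr_eq eab.
    + exact: (hsum_homog (a := al *+ (2 * i))).
  - by rewrite addr0 hornerD hornerN addrC subrK.
pose P := 'X - (Q \Po 'X^2).
have eP k : P`_k = (k == 1%N)%:R - if (2 %| k)%N then Q`_(k %/ 2) else 0.
  by rewrite /P coefB coefX coef_comp_poly_Xn.
apply: (unit_coef_root (be := al) (P := P) _ Au un0).
- by apply: icT => //; apply: hloc_overring.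
- move=> k; have gA := RH_comp_subgrp gdR (al - al *+ k).
  have [T1 A1] : hloc (k == 1%N)%:R /\ RH_comp C (al - al *+ k) (k == 1%N)%:R.
    case: eqP => [->|_]; last by split; [apply: subgrp0 | apply: (subgrp0 gA)].
    split; first exact: is_subring1.
    by rewrite mulr1n subrr; apply: (comp_RH_comp gdR); apply: comp1 gdR.
  rewrite eP; suff [T2 A2] : hloc (if (2 %| k)%N then Q`_(k %/ 2) else 0) /\
      RH_comp C (al - al *+ k) (if (2 %| k)%N then Q`_(k %/ 2) else 0).
    by split; [apply: (subgrpB gT) | apply: (subgrpB gA)].
  case: ifP => [dk|_]; last by split; [apply: subgrp0 | apply: (subgrp0 gA)].
  rewrite coef_poly; case: ifP => _; last by split; [apply: subgrp0 | apply: (subgrp0 gA)].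
  by have [[]] := cP (k %/ 2)%N; rewrite mulnC divnK.
- by apply/rootP; rewrite /P hornerD hornerN hornerX horner_comp hornerXn -eQ subrr.
- exists 1%N; rewrite eP /= subr0; split; first exact: oner_neq0.
  by rewrite invr1; apply: is_subring1.
Qed.

(** By [hloc_total] one of any two nonzero homogeneous elements divides the other in R_M. *)
Lemma hloc_divisor (s : seq K) : (forall x, x \in s -> exists a, C a x) ->
  (exists2 x, x \in s & x != 0) ->
  exists f, [/\ f \in s, f != 0 & forall x, x \in s -> hloc (x / f)].
Proof.
elim: s => [|a s IH] Cs [x0 sx0 x0n0]; first by [].
have [b Ca] := Cs a (mem_head _ _).
have [/hasP [y sy yn0]|/hasPn s0] := boolP (has (predC1 0) s); last first.
  have s00 x : x \in s -> x = 0 by move/s0/negPn/eqP.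
  exists a; split; first exact: mem_head.
    move: sx0; rewrite inE => /orP [/eqP <- //|/s00 x00]; by rewrite x00 eqxx in x0n0.
  move=> x; rewrite inE => /orP [/eqP ->|/s00 ->]; last by rewrite mul0r; apply: subgrp0.
  by have [->|an0] := eqVneq a 0; rewrite ?mul0r ?mulfV //; [apply: subgrp0 | apply: is_subring1].
have [||f [sf fn0 Hf]] := IH; first by move=> x xs; apply: Cs; rewrite inE xs orbT.
  by exists y.
have [c Cf] : exists c, C c f by apply: Cs; rewrite inE sf orbT.
have [Tfa|Tfa] : hloc (a / f) \/ hloc (f / a).
  have [->|an0] := eqVneq a 0; first by left; rewrite mul0r; apply: subgrp0.
  rewrite -[f / a]invf_div; apply: (@hloc_total (b - c)); last by rewrite mulf_neq0 ?invr_eq0.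
  by exists b, c, a, f.
- exists f; split=> //; first by rewrite inE sf orbT.
  by move=> x; rewrite inE => /orP [/eqP ->|/Hf].
have [a0|an0] := eqVneq a 0.
  exists f; split=> //; first by rewrite inE sf orbT.
  by move=> x; rewrite inE => /orP [/eqP ->|/Hf //]; rewrite a0 mul0r; apply: subgrp0.
exists a; split=> //; first exact: mem_head.
move=> x; rewrite inE => /orP [/eqP ->|/Hf Tx].
  by rewrite mulfV //; apply: is_subring1.
have -> : x / a = x / f * (f / a) by field; rewrite fn0 an0.
exact: is_subringM.
Qed.

Lemma hcompl_common (s : seq K) f : (forall x, x \in s -> hloc (x / f)) ->
  exists2 t, hcompl t & forall x, x \in s -> R (t * (x / f)).
Proof.
elim: s => [|a s IH] Hs; first by exists 1.
have [|t St Ht] := IH; first by move=> x xs; apply: Hs; rewrite inE xs orbT.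
have [b [r [Rb Sr ea]]] := Hs a (mem_head _ _).
exists (t * r); first exact: hcomplM.
move=> x; rewrite inE => /orP [/eqP ->|/Ht Rx].
  have -> : t * r * (a / f) = t * b by rewrite ea; field; rewrite hcompl_n0.
  by apply: is_subringM => //; apply: hcomplR.
by rewrite mulrAC; apply: is_subringM => //; apply: hcomplR.
Qed.

End Valuation.
End Localization.

Lemma GPstarMD_of_int_closed :
  (forall T, homog_linked R C st T (@d_op K) -> int_closed T) -> GPstarMD R C st.
Proof.
move=> P5 I nI; have [hI fI n_I] := nI; pose I0 := prodm I (colon R I).
have [s [Cs eI]] := homog_generators rR hI fI.
have sn0 : exists2 x, x \in s & x != 0 by apply: (@gen_nonzero _ R); rewrite -eI.
have I0R : I0 `<=` R by apply: prodm_colon_sub.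
have sI0 : is_submod R I0 by apply: prodm_submod; case: hI.
have nzR : nz_submod R R := nz_fg_homog_nz st_unitR.1.
rewrite /f_invertible -/I0.
(* A member of [st_unit] inside [I0] gives invertibility at once; its absence leads to the prime M
   and a contradiction. *)
have [[J [NJ JI]]|nJ] := pselect (exists J, st_unit J /\ J `<=` I0).
  apply/seteqP; split=> y.
    move=> [F [[t eF] nF FI]]; apply: (st_mono sst _ nzR).
      by split=> //; rewrite eF; apply: gen_submod.
    exact: (subset_trans FI).
  by case: NJ => [[hJ fJ nJ] <-] Jy; exists J.
have aI0 : avoids_units I0 by move=> J NJ JI; apply: nJ; exists J.
have hI0 : homog_ideal R C I0.
  split=> // y I0y; have {}I0y : prodm (gen R s) (colon R (gen R s)) y by rewrite -eI.
  have [u [Hu gu]] := colon_product_homog gdR Cs sn0 I0y.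
  set W := [seq a * b | a <- s, b <- u] in gu.
  have CW := comp_colon_products gdR Cs Hu.
  have [_ _ /(_ y gu) [t [f [ut Hf ey]]]] := gen_homog_idealR gdR CW.
  exists t, f; split=> // a /Hf [Ca gf]; split=> //.
  apply: gen_sub gf => // _ /allpairsP [[a' b'] /= [sa ub ->]].
  apply: prodm_mem; first by rewrite eI; apply: gen_mem.
  by rewrite eI; have [] := Hu b' ub.
have [M [hM IM aM pM]] := exists_prime hI0 aI0.
have icT T : homog_overring R C T -> hloc M `<=` T -> int_closed T.
  by move=> oT lT; apply: P5; apply: (hloc_linked hM aM).
have [f [sf fn0 Hf]] := hloc_divisor hM aM pM icT Cs sn0.
(* Since t clears the denominators of all x / f, the quotient t / f lies in (R : I); hence t = f (t
   / f) lies in [I0], inside M, although t was chosen outside M. *)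
have [t [Ct nMt] Ht] := hcompl_common hM aM pM Hf.
case: nMt; apply: IM; have -> : t = f * (t / f) by field.
apply: prodm_mem; first by rewrite eI; apply: gen_mem.
rewrite eI; apply: colon_genP => // x xs.
by have -> : t / f * x = t * (x / f) by [rewrite mulrAC mulrA]; apply: Ht.
Qed.

End Converse.

Theorem theorem3p7 (K : fieldType) (G : zmodType) (Gam : set G) (R : set K)
    (C : G -> set K) (st : set K -> set K) :
  graded_domain Gam R C ->
  is_semistar R st ->
  st R `<=` RH C R -> st R <> RH C R ->
  let P1 := GPstarMD R C st in
  let P2 := forall T, homog_linked R C st T (t_op T) -> PvMD T in
  let P3 := forall T, homog_linked R C st T (@d_op K) -> graded_Prufer C T in
  let P4 := forall T, homog_linked R C st T (t_op T) -> int_closed T in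
  let P5 := forall T, homog_linked R C st T (@d_op K) -> int_closed T in
  [/\ P1 <-> P2, P1 <-> P3, P1 <-> P4 & P1 <-> P5].
Proof.
move=> gdR sst _ _ P1 P2 P3 P4 P5.
(* The implications are (1) => (2) => (4) => (5) => (1) and (1) => (3) => (5). *)
have P12 : P1 -> P2 by move=> p1 T lT; exact: (GPstarMD_PvMD gdR sst p1 lT).
have P13 : P1 -> P3 by move=> p1 T lT; exact: (GPstarMD_graded_Prufer gdR sst p1 lT).
have icPvMD T : homog_overring R C T -> PvMD T -> int_closed T.
  move=> oT; have [rT _ _ _] := oT; apply: int_closed_of_PvMD => //.
  exact: (homog_overring_frac gdR oT).
have P24 : P2 -> P4 by move=> p2 T lT; apply: icPvMD; [case: lT | apply: p2].
have P45 : P4 -> P5 by move=> p4 T lT; apply: p4; apply: homog_linked_d_t.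
have P35 : P3 -> P5.
  move=> p3 T lT; have [oT _] := lT; apply: icPvMD => //.
  by apply: (graded_Prufer_PvMD gdR oT); apply: p3.
have P51 : P5 -> P1 := GPstarMD_of_int_closed gdR sst.
by split; split; auto.
Qed.
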